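(* Let $Q$ be a finite quiver and $k=\mathbb{F}_q$. The map $\int_\Delta:=(\int\otimes\int)\circ\Delta: H(Q)\to \mathcal{P}_{\langle Q^2\rangle}$ is an algebra morphism. For every finite-dimensional representation $W$ of $Q$, of dimension vector $\alpha$, $$\int_\Delta([W])=\frac{1}{a_W}\sum_{\gamma}|\mathrm{Gr}_\gamma(W)|\,x^{\alpha-\gamma}y^{\gamma}.$$ Moreover, for all finite-dimensional representations $U,V$ of $Q$ of dimension vectors $\alpha_1,\alpha_2$ and every dimension vector $\gamma$, $$\sum_{\gamma_1+\gamma_2=\gamma}\langle\gamma_1,\beta_2\rangle\,|\mathrm{Gr}_{\gamma_1}(U)|\,|\mathrm{Gr}_{\gamma_2}(V)|=\sum_{[W]}\frac{|\mathrm{Ext}_Q(U,V)_W|}{|\mathrm{Ext}_Q(U,V)|}\,|\mathrm{Gr}_{\gamma}(W)|,$$ where $\beta_2=\alpha_2-\gamma_2$, the left sum runs over pairs of dimension vectors $\gamma_1\le\alpha_1$, $\gamma_2\le\alpha_2$ with $\gamma_1+\gamma_2=\gamma$, and the right sum runs over isomorphism classes $[W]$.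
   Context: $k=\mathbb{F}_q$ is a finite field; all representations are finite-dimensional over $k$. $Q$ has vertex set $Q_0$, arrow set $Q_1$; an arrow $a$ goes from $ta$ to $ha$. The additive Euler form is $\langle\alpha,\beta\rangle_a=\sum_{v\in Q_0}\alpha(v)\beta(v)-\sum_{a\in Q_1}\alpha(ta)\beta(ha)$, and $\langle\alpha,\beta\rangle:=q^{\langle\alpha,\beta\rangle_a}$. $\mathrm{Ext}_Q=\mathrm{Ext}^1$. $a_M:=|\mathrm{Aut}_Q(M)|$. $\mathrm{Gr}_\gamma(M)$ is the set of subrepresentations of $M$ of dimension vector $\gamma$. $\mathrm{Ext}_Q(U,V)_W\subset\mathrm{Ext}_Q(U,V)$ is the set of classes of extensions $0\to V\to E\to U\to 0$ with $E\cong W$. The Hall number $F_{UV}^W$ is the number of subrepresentations $V'\subset W$ with $V'\cong V$ and $W/V'\cong U$. The completed Hall algebra $H(Q)$ is the space of all formal (possibly infinite) $\mathbb{C}$-linear combinations of isomorphism classes $[M]$, with multiplication $[U][V]=\sum_{[W]}F_{UV}^W[W]$ and unit $[0]$. The comultiplication (with values in the completed tensor product) is $$\Delta([W])=\sum_{[U],[V]}F_{UV}^W\frac{a_Ua_V}{a_W}[U]\otimes[V].$$ The map $\int$ sends $[M]$ to $\frac{1}{a_M}t^{\alpha}$, where $\alpha$ is the dimension vector of $M$; $\int\otimes\int$ sends $[U]\otimes[V]$, with $U,V$ of dimension vectors $\beta,\gamma$, to $\frac{1}{a_Ua_V}x^{\beta}y^{\gamma}$ (all extended linearly to infinite sums).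 $\mathcal{P}_{\langle Q^2\rangle}$ is the algebra of formal (possibly infinite) $\mathbb{C}$-linear combinations of monomials $x^\beta y^\gamma$ with $\beta,\gamma\in\mathbb{Z}_{\ge0}^{Q_0}$, with multiplication $$(x^{\beta_1}y^{\gamma_1})(x^{\beta_2}y^{\gamma_2})=\frac{\langle\gamma_1,\beta_2\rangle}{\langle\beta_1+\gamma_1,\beta_2+\gamma_2\rangle}x^{\beta_1+\beta_2}y^{\gamma_1+\gamma_2}.$$ *)

(* Defs.v *)
From HB Require Import structures.
From mathcomp Require Import all_boot all_order all_algebra.
From mathcomp Require Import mxrepresentation complex.
From mathcomp Require Import boolp classical_sets functions cardinality fsbigop.
From mathcomp Require Import reals.

Set Implicit Arguments.
Unset Strict Implicit.
Unset Printing Implicit Defensive.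

Import Order.TTheory GRing.Theory Num.Theory.
Local Open Scope ring_scope.
Local Open Scope quotient_scope.

Record quiver := Quiver {
  vert : finType;
  arrow : finType;
  tl : arrow -> vert;
  hd : arrow -> vert }.

Notation dimvec Q := {ffun vert Q -> nat}.

Definition dim_le (Q : quiver) (b a : dimvec Q) : bool :=
  [forall v, (b v <= a v)%N].

(* Truncated pointwise subtraction, only used as [dim_sub a b] with b <= a. *)
Definition dim_sub (Q : quiver) (a b : dimvec Q) : dimvec Q :=
  [ffun v => (a v - b v)%N].

Definition euler_add (Q : quiver) (a b : dimvec Q) : int :=
  \sum_v (a v)%:Z * (b v)%:Z - \sum_e (a (tl e))%:Z * (b (hd e))%:Z.

Definition euler (R : realType) (k : finFieldType) (Q : quiver)
    (a b : dimvec Q) : R[i] := (#|k|%:R : R[i]) ^ euler_add a b.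

(* Representations are in coordinates: the space at the vertex v is 'rV[k]_(d v),
    and the arrow e maps the row vector u to u *m M e.  Homomorphisms also act
    on row vectors on the right.  Dimensions are plain functions here, so that
    the dimensions of subobjects, quotients and extensions compute. *)

Section Representations.
Variables (k : finFieldType) (Q : quiver).
Implicit Types d : vert Q -> nat.

Definition rep d : Type :=
  {dffun forall e : arrow Q, 'M[k]_(d (tl e), d (hd e))}.
HB.instance Definition _ d := Finite.copy (rep d)
  {dffun forall e : arrow Q, 'M[k]_(d (tl e), d (hd e))}.

Definition vmaps d1 d2 : Type := {dffun forall v : vert Q, 'M[k]_(d1 v, d2 v)}.
HB.instance Definition _ d1 d2 := Finite.copy (vmaps d1 d2)
  {dffun forall v : vert Q, 'M[k]_(d1 v, d2 v)}.

Definition is_hom d1 d2 (M : rep d1) (N : rep d2) (g : vmaps d1 d2) : bool :=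
  [forall e : arrow Q, (M e *m g (hd e) == g (tl e) *m N e)].

Definition is_iso d1 d2 (M : rep d1) (N : rep d2) (g : vmaps d1 d2) : bool :=
  is_hom M N g && [forall v, row_free (g v) && row_full (g v)].

Definition iso d1 d2 (M : rep d1) (N : rep d2) : bool :=
  [exists g : vmaps d1 d2, is_iso M N g].

Definition aut_card d (M : rep d) : nat := #|[set g : vmaps d d | is_iso M M g]|.

(* [<<_>>%MS] picks one matrix for each row space, hence each subrepresentation
   is represented by exactly one family N. *)
Definition is_subrep d (W : rep d) (N : vmaps d d) : bool :=
  [forall v, <<N v>>%MS == N v]
  && [forall e : arrow Q, (N (tl e) *m W e <= N (hd e))%MS].

Definition subrep d (W : rep d) (N : vmaps d d) : rep (fun v => \rank (N v)) :=
  [ffun e => in_submod (N (hd e)) (@val_submod _ _ (N (tl e)) _ 1%:M *m W e)].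

Definition quorep d (W : rep d) (N : vmaps d d) :
    rep (fun v => \rank (cokermx (N v))) :=
  [ffun e => in_factmod (N (hd e)) (@val_factmod _ _ (N (tl e)) _ 1%:M *m W e)].

Definition Gr (g : dimvec Q) d (W : rep d) : {set vmaps d d} :=
  [set N | is_subrep W N && [forall v, \rank (N v) == g v]].

Definition hall_num d1 d2 d (U : rep d1) (V : rep d2) (W : rep d) : nat :=
  #|[set N : vmaps d d |
      [&& is_subrep W N, iso (subrep W N) V & iso (quorep W N) U]]|.

(* Yoneda Ext^1(U, V): classes of extensions 0 -> V -i-> E -p-> U -> 0.  The
    middle term is taken on the dimension vector dim U + dim V, which is forced
    by exactness. *)

Definition ext_data d1 d2 : Type :=
  (rep (fun v => d1 v + d2 v)%N * vmaps d2 (fun v => d1 v + d2 v)%N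
   * vmaps (fun v => d1 v + d2 v)%N d1)%type.
HB.instance Definition _ d1 d2 := Finite.copy (ext_data d1 d2)
  (rep (fun v => d1 v + d2 v)%N * vmaps d2 (fun v => d1 v + d2 v)%N
   * vmaps (fun v => d1 v + d2 v)%N d1)%type.

Definition ext_mid d1 d2 (x : ext_data d1 d2) := x.1.1.
Definition ext_inj d1 d2 (x : ext_data d1 d2) := x.1.2.
Definition ext_proj d1 d2 (x : ext_data d1 d2) := x.2.

Definition is_ext d1 d2 (U : rep d1) (V : rep d2) (x : ext_data d1 d2) : bool :=
  [&& is_hom V (ext_mid x) (ext_inj x), is_hom (ext_mid x) U (ext_proj x)
    & [forall v, [&& row_free (ext_inj x v), row_full (ext_proj x v)
                   & (ext_inj x v == kermx (ext_proj x v))%MS]]].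

Definition ext_equiv d1 d2 (x y : ext_data d1 d2) : bool :=
  [exists g : vmaps (fun v => d1 v + d2 v)%N (fun v => d1 v + d2 v)%N,
    is_iso (ext_mid x) (ext_mid y) g
    && [forall v, (ext_inj x v *m g v == ext_inj y v)
                  && (g v *m ext_proj y v == ext_proj x v)]].

Definition Ext d1 d2 (U : rep d1) (V : rep d2) : {set {set ext_data d1 d2}} :=
  equivalence_partition (@ext_equiv d1 d2) [set x | is_ext U V x].

Definition Ext_mid d1 d2 (U : rep d1) (V : rep d2) d (W : rep d) :
    {set {set ext_data d1 d2}} :=
  [set c in Ext U V | [exists x in c, iso (ext_mid x) W]].

Lemma iso_refl d (M : rep d) : iso M M.
Proof.
apply/existsP; exists [ffun v => 1%:M]; apply/andP; split.
  by apply/forallP => e; rewrite !ffunE mulmx1 mul1mx.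
by apply/forallP => v; rewrite ffunE row_free_unit row_full_unit unitmx1.
Qed.

Lemma iso_sym_imp d1 d2 (M : rep d1) (N : rep d2) : iso M N -> iso N M.
Proof.
case/existsP => g /andP[/forallP gM /forallP gb].
have gV v : g v *m pinvmx (g v) = 1%:M.
  by have /andP[? ?] := gb v; rewrite mulmxVp.
have Vg v : pinvmx (g v) *m g v = 1%:M.
  by have /andP[? ?] := gb v; rewrite mulVpmx.
apply/existsP; exists [ffun v => pinvmx (g v)]; apply/andP; split.
  apply/forallP => e; rewrite !ffunE; apply/eqP.
  rewrite -[LHS]mul1mx -(Vg (tl e)) -mulmxA; congr (_ *m _).
  by rewrite mulmxA -(eqP (gM e)) -mulmxA gV mulmx1.
apply/forallP => v; rewrite ffunE; apply/andP; split.
  by apply/row_freeP; exists (g v).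
by apply/row_fullP; exists (g v).
Qed.

Lemma iso_trans_imp d1 d2 d3 (M : rep d1) (N : rep d2) (P : rep d3) :
  iso M N -> iso N P -> iso M P.
Proof.
case/existsP => g /andP[/forallP gM /forallP gb].
case/existsP => h /andP[/forallP hM /forallP hb].
apply/existsP; exists [ffun v => g v *m h v]; apply/andP; split.
  apply/forallP => e; rewrite !ffunE; apply/eqP.
  by rewrite mulmxA (eqP (gM e)) -!mulmxA (eqP (hM e)).
apply/forallP => v; rewrite ffunE.
have /andP[/row_freeP[g1 g1K] /row_fullP[g2 g2K]] := gb v.
have /andP[/row_freeP[h1 h1K] /row_fullP[h2 h2K]] := hb v.
apply/andP; split.
  by apply/row_freeP; exists (h1 *m g1); rewrite mulmxA -(mulmxA (g v)) h1K mulmx1.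
by apply/row_fullP; exists (h2 *m g2); rewrite mulmxA -(mulmxA h2) g2K mulmx1.
Qed.

Definition anyrep : Type := {d : dimvec Q & rep d}.
HB.instance Definition _ := Choice.copy anyrep {d : dimvec Q & rep d}.

Definition iso_any (M N : anyrep) : bool := iso (tagged M) (tagged N).

Lemma iso_any_refl : reflexive iso_any.
Proof. by move=> M; apply: iso_refl. Qed.

Lemma iso_any_sym : symmetric iso_any.
Proof. by move=> M N; apply/idP/idP; apply: iso_sym_imp. Qed.

Lemma iso_any_trans : transitive iso_any.
Proof. by move=> N M P; apply: iso_trans_imp. Qed.

Canonical iso_equiv := EquivRel iso_any iso_any_refl iso_any_sym iso_any_trans.

Definition isocl : Type := {eq_quot iso_any}.
HB.instance Definition _ := Choice.copy isocl {eq_quot iso_any}.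

Definition iclass (d : dimvec Q) (M : rep d) : isocl :=
  \pi_{eq_quot iso_any} (Tagged (fun d : dimvec Q => rep d) M).

Definition cdim (X : isocl) : dimvec Q := tag (repr (X : {eq_quot iso_any})).
Definition crep (X : isocl) : rep (cdim X) :=
  tagged (repr (X : {eq_quot iso_any})).

Definition zero_rep : rep ([ffun=> 0%N] : dimvec Q) := [ffun=> 0].

End Representations.

(* A formal infinite linear combination is its function of coefficients.  All sums
    below are finitely supported: in each of them the dimension vectors of the
    contributing terms are bounded and k is finite. *)

Section HallAlgebra.
Variables (R : realType) (k : finFieldType) (Q : quiver).
Local Notation C := R[i].
Local Notation cl := (isocl k Q).
Local Notation mono := (dimvec Q * dimvec Q)%type.

Definition cl_aut (X : cl) : C := (aut_card (crep X))%:R.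
Definition cl_hall (X Y Z : cl) : C := (hall_num (crep X) (crep Y) (crep Z))%:R.

Definition hallalg : Type := cl -> C^o.
HB.instance Definition _ := GRing.Lmodule.copy hallalg (cl -> C^o).

Definition hall_basis (X : cl) : hallalg := fun Y => (Y == X)%:R.

Definition hall_one : hallalg := hall_basis (iclass (zero_rep k Q)).

Definition hall_mul (f g : hallalg) : hallalg := fun Z =>
  \sum_(XY \in [set: cl * cl]%classic)
    f XY.1 * g XY.2 * cl_hall XY.1 XY.2 Z.

(* Coefficient functions on pairs of classes, i.e. elements of the completed
   tensor square. *)
Definition halltensor : Type := cl * cl -> C.

Definition hall_comul (f : hallalg) : halltensor := fun XY =>
  \sum_(Z \in [set: cl]%classic)
    f Z * (cl_hall XY.1 XY.2 Z * (cl_aut XY.1 * cl_aut XY.2 / cl_aut Z)).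

(* The coefficient of x^b y^g is the value at (b, g). *)
Definition powalg : Type := mono -> C^o.
HB.instance Definition _ := GRing.Lmodule.copy powalg (mono -> C^o).

Definition pow_mono (b g : dimvec Q) : powalg := fun m => (m == (b, g))%:R.

Definition pow_one : powalg := pow_mono 0 0.

Definition pow_mul (p r : powalg) : powalg := fun m =>
  \sum_(st \in [set st : mono * mono |
                  st.1.1 + st.2.1 = m.1 /\ st.1.2 + st.2.2 = m.2]%classic)
    p st.1 * r st.2 *
    (euler R k st.1.2 st.2.1 / euler R k (st.1.1 + st.1.2) (st.2.1 + st.2.2)).

Definition int_tensor (c : halltensor) : powalg := fun m =>
  \sum_(XY \in [set XY : cl * cl | cdim XY.1 = m.1 /\ cdim XY.2 = m.2]%classic)
    c XY * (cl_aut XY.1 * cl_aut XY.2)^-1.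

Definition int_Delta (f : hallalg) : powalg := int_tensor (hall_comul f).

End HallAlgebra.

Arguments hall_one : clear implicits.
Arguments hall_mul : clear implicits.
Arguments pow_one : clear implicits.
Arguments pow_mul : clear implicits.
Arguments int_Delta : clear implicits.
Arguments rep : clear implicits.

Definition algebra_morphism (K : pzRingType) (A B : lmodType K)
    (oneA : A) (mulA : A -> A -> A) (oneB : B) (mulB : B -> B -> B)
    (f : A -> B) : Prop :=
  [/\ linear f, f oneA = oneB & {morph f : x y / mulA x y >-> mulB x y}].

(* Main.v *)
Require Import Defs.
From HB Require Import structures.
From mathcomp Require Import complex boolp classical_sets functions fsbigop reals.
From mathcomp Require Import all_boot all_order all_algebra.
From mathcomp Require Import mxrepresentation.
From mathcomp Require Import zify ring.

Set Implicit Arguments.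
Unset Strict Implicit.
Unset Printing Implicit Defensive.
Import Order.TTheory GRing.Theory Num.Theory.
Local Open Scope ring_scope.

(** Everything is counted through explicit extensions.  For a family c of linear
    maps c_e : U_(te) -> V_(he), let E_c be the representation on the direct sum
    of U and V whose arrow e is the block matrix with rows (U_e, c_e) and
    (0, V_e) ([ext_rep]); let Z be the space of all such c.

    Every extension of U by V is equivalent to some E_c, and E_c, E_c' are
    equivalent exactly when c' - c is a coboundary e |-> U_e h_(he) - h_(te) V_e.
    So Z maps onto Ext(U, V) with fibres of one common size, and
    |Ext(U, V)_W| / |Ext(U, V)| is the proportion of the c in Z with E_c
    isomorphic to W ([card_Ext], [card_Ext_mid]).  The right side of the last
    identity is therefore the mean of |Gr_g(E_c)| over c in Z.

    To compute that mean, sort the subspaces N of the direct sum by their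
    projection N1 to U and their intersection N2 with V.  Each of them is
    { (y1, y2) : y1 in N1, y2 - y1 h in N2 } for some h, unique modulo the maps
    sending N1 into N2, and it is stable under E_c iff N1 and N2 are
    subrepresentations and c minus the coboundary of h sends N1 into N2.  Counting
    the pairs (c, h) in two ways shows that there are |Z| <dim N1, dim V - dim N2>
    pairs (c, N) of type (N1, N2) ([card_subrep_type]); the sum over (N1, N2) is
    the left side ([sum_Gr_ext]).

    For the algebra morphism, the coefficient of x^b y^g in int_Delta f is the sum
    of f(Z) |Gr_g(Z)| / a_Z over the classes Z of dimension b + g, because every
    subrepresentation of Z is counted by exactly one Hall number ([int_DeltaE]).
    This gives the formula for int_Delta [W].  Riedtmann's formula
    ([riedtmann]) expresses F_(UV)^W a_U a_V / a_W by the number of c with E_c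
    isomorphic to W: pairs (c, isomorphism E_c -> W) map onto the short exact
    sequences 0 -> V -> W -> U -> 0, with fibres in bijection with the vertexwise
    linear maps U -> V.  Hence the coefficient of y^g in int_Delta ([U][V]) is
    1 / (a_U a_V <dim U, dim V>) times the mean above, and the identity for that
    mean is precisely the multiplication rule of the target algebra. *)

(** * Counting lemmas *)

Lemma card_fibers (aT rT : finType) (A : {set aT}) (B : {set rT})
    (f : aT -> rT) (n : nat) :
    {in A, forall x, f x \in B} ->
    {in B, forall y, #|[set x in A | f x == y]| = n} ->
  #|A| = (#|B| * n)%N.
Proof.
move=> fAB fn; rewrite -sum1_card (partition_big f (mem B)) //=.
rewrite -sum_nat_const; apply: eq_bigr => y yB.
by rewrite -(fn y yB) -sum1_card; apply: eq_bigl => x; rewrite inE.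
Qed.

Lemma card_dffun_forall (I : finType) (T : I -> finType)
    (P : forall i, pred (T i)) :
  #|[set g : {dffun forall i, T i} | [forall i, P i (g i)]]| = (\prod_i #|P i|)%N.
Proof.
transitivity #|(family P : simpl_pred {dffun forall i, T i})|.
  by apply: eq_card => g; rewrite inE; apply/forallP/familyP.
by rewrite card_family foldrE big_map -big_enum; apply: eq_bigl.
Qed.

Section LinAlg.
Variable k : finFieldType.

(** Modulo B, and restricted to the row space of A, a matrix x gives an arbitrary
    linear map of size \rank A by (r - \rank B); the condition prescribes that
    map to be the one given by x0. *)
Lemma card_mx_le_shift m n p r (A : 'M[k]_(m, n)) (B : 'M[k]_(p, r))
    (x0 : 'M_(n, r)) :
  (#|[pred x : 'M[k]_(n, r) | (A *m (x - x0) <= B)%MS]|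
   * #|k| ^ (\rank A * (r - \rank B)) = #|k| ^ (n * r))%N.
Proof.
pose K := col_base (cokermx B).
pose f (h : 'M[k]_(n, r)) := row_base A *m h *m K.
have fB x y : f (x - y) = f x - f y by rewrite /f mulmxBr mulmxBl.
have fD x y : f (x + y) = f x + f y by rewrite /f mulmxDr mulmxDl.
have f0 h : (f h == 0) = (A *m h <= B)%MS.
  have -> : (A *m h <= B)%MS = (A *m h *m cokermx B == 0) by rewrite submxE.
  have -> : A *m h *m cokermx B = col_base A *m f h *m row_base (cokermx B).
    by rewrite -{1}(mulmx_base A) -{1}(mulmx_base (cokermx B)) /f
      -!(mulmxA (col_base _)) -!(mulmxA (row_base A)) -!(mulmxA h).
  apply/eqP/eqP=> [->|H]; first by rewrite mulmx0 mul0mx.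
  apply: (row_full_inj (col_base_full A)).
  by apply: (row_free_inj (row_base_free (cokermx B))); rewrite H mulmx0 mul0mx.
rewrite -mxrank_coker -!card_mx -[in RHS]cardsT mulnC -[X in (X * _)%N]cardsT.
apply/esym/(card_fibers (f := f)) => // w _.
have /row_freeP[A' A'K] := row_base_free A.
have /row_fullP[K' K'K] := col_base_full (cokermx B).
pose h0 := A' *m w *m K'.
have fh0 : f h0 = w.
  rewrite /f /h0 (mulmxA _ (A' *m w)) (mulmxA _ A') A'K mul1mx.
  by rewrite -mulmxA K'K mulmx1.
rewrite -[LHS](card_imset _ (addrI (x0 - h0))); apply: eq_card => h.
rewrite [RHS]inE; apply/imsetP/idP => [[x] | Ah].
  rewrite inE in_setT /= => /eqP fx ->.
  have -> : x0 - h0 + x - x0 = x - h0 by rewrite addrC !addrA addNr sub0r addrC.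
  by rewrite -f0 fB fx fh0 subrr.
exists (h - (x0 - h0)); last by rewrite addrC subrK.
rewrite inE in_setT /= opprB [h0 - x0]addrC addrA fD fh0.
by move: Ah; rewrite -f0 => /eqP ->; rewrite add0r.
Qed.

End LinAlg.

(** * Subspaces of a direct sum of two vector spaces *)

Section GraphSubspace.
Variable k : fieldType.
Variables n1 n2 : nat.

(** The row vectors (y1, y2) with y1 in A and y2 in the coset y1 h + B, see
    [submx_graph]: the graph of the map from A to the quotient by B that h
    induces. *)
Definition graph_mx m1 m2 (A : 'M[k]_(m1, n1)) (B : 'M[k]_(m2, n2))
    (h : 'M[k]_(n1, n2)) : 'M[k]_(n1 + n2) :=
  <<col_mx (row_mx A (A *m h)) (row_mx 0 B)>>%MS.

Definition proj_mx1 m (N : 'M[k]_(m, n1 + n2)) : 'M[k]_n1 :=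
  <<N *m col_mx 1%:M 0>>%MS.

(** The intersection of N with the second summand. *)
Definition fiber_mx m (N : 'M[k]_(m, n1 + n2)) : 'M[k]_n2 :=
  <<(N :&: row_mx 0 1%:M)%MS *m col_mx 0 1%:M>>%MS.

Lemma mulmx_prj1 m (M : 'M[k]_(m, n1 + n2)) : M *m col_mx 1%:M 0 = lsubmx M.
Proof. by rewrite -{1}[M]hsubmxK mul_row_col mulmx1 mulmx0 addr0. Qed.

Lemma mulmx_prj2 m (M : 'M[k]_(m, n1 + n2)) : M *m col_mx 0 1%:M = rsubmx M.
Proof. by rewrite -{1}[M]hsubmxK mul_row_col mulmx1 mulmx0 add0r. Qed.

Lemma submx_graph m m1 m2 (A : 'M[k]_(m1, n1)) (B : 'M[k]_(m2, n2)) h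
    (Y1 : 'M_(m, n1)) (Y2 : 'M_(m, n2)) :
  (row_mx Y1 Y2 <= graph_mx A B h)%MS = (Y1 <= A)%MS && (Y2 - Y1 *m h <= B)%MS.
Proof.
rewrite genmxE; apply/submxP/andP => [[D] | [/submxP[D1 ->] /submxP[D2 Y2E]]].
  rewrite -[D]hsubmxK mul_row_col !mul_mx_row add_row_mx mulmx0 addr0.
  case/eq_row_mx => -> ->; rewrite submxMl mulmxA addrC addKr.
  by rewrite submxMl.
exists (row_mx D1 D2); rewrite mul_row_col !mul_mx_row add_row_mx mulmx0 addr0.
by rewrite -Y2E mulmxA addrC subrK.
Qed.

Lemma mxrank_graph m1 m2 (A : 'M[k]_(m1, n1)) (B : 'M[k]_(m2, n2)) h :
  \rank (graph_mx A B h) = (\rank A + \rank B)%N.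
Proof.
rewrite genmxE -rank_diag_block_mx.
have -> : col_mx (row_mx A (A *m h)) (row_mx 0 B) =
    block_mx A 0 0 B *m block_mx 1%:M h 0 1%:M.
  by rewrite mulmx_block !mulmx0 !mul0mx !mulmx1 !addr0 !add0r.
by rewrite mxrankMfree // row_free_unit unitmxE det_ublock !det1 mulr1 unitr1.
Qed.

Lemma submx_fiber m p (N : 'M[k]_(m, n1 + n2)) (Y : 'M_(p, n2)) :
  (Y <= fiber_mx N)%MS = (row_mx 0 Y <= N)%MS.
Proof.
rewrite genmxE; apply/idP/idP => [/submxP[D ->] | YN].
  have /submxP[E DE] : (D *m (N :&: row_mx 0 1%:M)%MS <= row_mx 0 1%:M)%MS.
    exact: submx_trans (submxMl _ _) (capmxSr _ _).
  have -> : row_mx 0 (D *m ((N :&: row_mx 0 1%:M)%MS *m col_mx 0 1%:M)) =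
      D *m (N :&: row_mx 0 1%:M)%MS.
    rewrite mulmxA DE -mulmxA mul_row_col mulmx0 mul1mx add0r.
    by rewrite mul_mx_row mulmx0 mulmx1.
  exact: submx_trans (submxMl _ _) (capmxSl _ _).
have -> : Y = row_mx (0 : 'M_(p, n1)) Y *m col_mx 0 1%:M.
  by rewrite mul_row_col mul0mx add0r mulmx1.
apply: submxMr; rewrite sub_capmx YN.
by apply/submxP; exists Y; rewrite mul_mx_row mulmx0 mulmx1.
Qed.

Lemma proj_graph m1 m2 (A : 'M[k]_(m1, n1)) (B : 'M[k]_(m2, n2)) h :
  proj_mx1 (graph_mx A B h) = <<A>>%MS.
Proof.
apply: eq_genmx; apply: eqmx_trans (eqmxMr _ (genmxE _)) _.
rewrite mul_col_mx !mul_row_col mul0mx !mulmx0 !mulmx1 !addr0.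
by apply/eqmxP; rewrite col_mx_sub submx_refl sub0mx -addsmxE addsmxSl.
Qed.

Lemma fiber_graph m1 m2 (A : 'M[k]_(m1, n1)) (B : 'M[k]_(m2, n2)) h :
  fiber_mx (graph_mx A B h) = <<B>>%MS.
Proof.
apply/eqP; rewrite -[fiber_mx _]genmx_id; apply/eqP/genmxP.
apply/andP; split.
  have := submx_refl (fiber_mx (graph_mx A B h)).
  by rewrite submx_fiber submx_graph sub0mx mul0mx subr0.
by rewrite submx_fiber submx_graph sub0mx mul0mx subr0 submx_refl.
Qed.

(** The map h is the second component of a linear section of the projection of N
    to the first summand. *)
Lemma graph_surj (N : 'M[k]_(n1 + n2)) :
  exists h, graph_mx (proj_mx1 N) (fiber_mx N) h = <<N>>%MS.
Proof.
pose P := N *m col_mx 1%:M 0 : 'M_(_, n1).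
exists (pinvmx P *m N *m col_mx 0 1%:M).
set h := _ *m _ *m _.
have lift p (Y : 'M_(p, n1)) :
    (Y <= P)%MS -> row_mx Y (Y *m h) = Y *m pinvmx P *m N.
  move=> YP; rewrite -[RHS]hsubmxK; congr row_mx.
    by rewrite -mulmx_prj1 -mulmxA; apply/esym/mulmxKpV.
  by rewrite /h !mulmxA mulmx_prj2.
apply/eqP; rewrite -[graph_mx _ _ _]genmx_id; apply/eqP/genmxP.
apply/andP; split.
  rewrite genmxE col_mx_sub; apply/andP; split.
    by rewrite lift ?genmxE // submxMl.
  by rewrite -submx_fiber.
rewrite -[X in (X <= _)%MS]hsubmxK submx_graph genmxE.
have NP : (lsubmx N <= P)%MS.
  by rewrite /P mulmx_prj1.
rewrite NP submx_fiber.
have -> : row_mx 0 (rsubmx N - lsubmx N *m h) =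
    N - row_mx (lsubmx N) (lsubmx N *m h).
  by rewrite -{3}[N]hsubmxK opp_row_mx add_row_mx subrr.
by rewrite addmx_sub // eqmx_opp lift // submxMl.
Qed.

Lemma graph_eq m1 m2 (A : 'M[k]_(m1, n1)) (B : 'M[k]_(m2, n2)) h h' :
  (graph_mx A B h == graph_mx A B h') = (A *m (h - h') <= B)%MS.
Proof.
have le h1 h2 : (A *m (h1 - h2) <= B)%MS -> (graph_mx A B h1 <= graph_mx A B h2)%MS.
  move=> AB; rewrite {1}/graph_mx genmxE col_mx_sub !submx_graph submx_refl.
  by rewrite -mulmxBr AB sub0mx mul0mx subr0 submx_refl.
apply/eqP/idP => [E | AB].
  have : (row_mx A (A *m h) <= graph_mx A B h)%MS.
    by rewrite submx_graph submx_refl subrr sub0mx.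
  by rewrite E submx_graph submx_refl -mulmxBr.
rewrite -[LHS]genmx_id -[RHS]genmx_id; apply/genmxP/andP; split; apply: le => //.
by rewrite -opprB mulmxN eqmx_opp.
Qed.

End GraphSubspace.

(** * Subrepresentations of the extensions E_c *)

Section Extensions.
Variables (k : finFieldType) (Q : quiver) (d1 d2 : vert Q -> nat).
Local Notation d12 := (fun v => d1 v + d2 v)%N.
Implicit Types (U : rep k Q d1) (V : rep k Q d2) (h : vmaps k d1 d2).
Implicit Types N : (vmaps k d1 d1 * vmaps k d2 d2)%type.

Definition cocycle : Type :=
  {dffun forall e : arrow Q, 'M[k]_(d1 (tl e), d2 (hd e))}.
HB.instance Definition _ := Finite.copy cocycle
  {dffun forall e : arrow Q, 'M[k]_(d1 (tl e), d2 (hd e))}.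

Definition ext_rep U V (c : cocycle) : rep k Q d12 :=
  [ffun e => block_mx (U e) (c e) 0 (V e)].

Definition cobound U V h (e : arrow Q) : 'M[k]_(d1 (tl e), d2 (hd e)) :=
  U e *m h (hd e) - h (tl e) *m V e.

Definition graph_sub (N : vmaps k d1 d1 * vmaps k d2 d2) h : vmaps k d12 d12 :=
  [ffun v => graph_mx (N.1 v) (N.2 v) (h v)].

Definition graph_type (M : vmaps k d12 d12) : vmaps k d1 d1 * vmaps k d2 d2 :=
  ([ffun v => proj_mx1 (M v : 'M_(_, d1 v + d2 v))],
   [ffun v => fiber_mx (M v : 'M_(_, d1 v + d2 v))]).

Lemma graph_type_graph N h :
    (forall v, <<N.1 v>>%MS = N.1 v) -> (forall v, <<N.2 v>>%MS = N.2 v) ->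
  graph_type (graph_sub N h) = N.
Proof.
case: N => N1 N2 /= N1K N2K; congr pair; apply/ffunP => v; rewrite !ffunE /=.
  by rewrite proj_graph.
by rewrite fiber_graph.
Qed.

Lemma graph_sub_surj (M : vmaps k d12 d12) :
  (forall v, <<M v>>%MS = M v) -> exists h, graph_sub (graph_type M) h = M.
Proof.
move=> NK; have /fin_all_exists[h hE] v := graph_surj (M v : 'M_(d1 v + d2 v)).
exists [ffun v => h v]; apply/ffunP => v; rewrite !ffunE /= hE.
exact: NK.
Qed.

(** On a vector (y1, y1 h) of the graph, the arrow e of E_c gives
    (y1 U_e, y1 (c_e + h V_e)); its second entry differs from y1 U_e h by
    y1 (c_e - (U_e h - h V_e)), which must lie in N.2. *)
Lemma is_subrep_graph U V c N h :
  (forall v, <<N.1 v>>%MS = N.1 v) -> (forall v, <<N.2 v>>%MS = N.2 v) ->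
  is_subrep (ext_rep U V c) (graph_sub N h) =
  [&& is_subrep U N.1, is_subrep V N.2 &
    [forall e, (N.1 (tl e) *m (c e - cobound U V h e) <= N.2 (hd e))%MS]].
Proof.
case: N => N1 N2 /= N1K N2K; rewrite /is_subrep.
have -> : [forall v, <<graph_sub (N1, N2) h v>>%MS == graph_sub (N1, N2) h v].
  by apply/forallP => v; rewrite ffunE genmx_id.
have -> : [forall v, <<N1 v>>%MS == N1 v] by apply/forallP => v; rewrite N1K.
have -> : [forall v, <<N2 v>>%MS == N2 v] by apply/forallP => v; rewrite N2K.
have step e : (graph_sub (N1, N2) h (tl e) *m ext_rep U V c e <=
     graph_sub (N1, N2) h (hd e))%MS =
  [&& (N1 (tl e) *m U e <= N1 (hd e))%MS, (N2 (tl e) *m V e <= N2 (hd e))%MS &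
      (N1 (tl e) *m (c e - cobound U V h e) <= N2 (hd e))%MS].
  rewrite !ffunE /= (eqmxMr _ (genmxE _)) mul_col_mx col_mx_sub.
  rewrite !mul_row_block !mulmx0 !addr0 !mul0mx !add0r !submx_graph.
  rewrite sub0mx mul0mx subr0 /= -andbA; congr andb; rewrite andbC; congr andb.
  by rewrite /cobound opprB addrA mulmxBr mulmxDr !mulmxA addrC.
rewrite /=; apply/forallP/and3P => [H | [/forallP H1 /forallP H2 /forallP H3] e].
  by split; apply/forallP => e; have := H e; rewrite step => /and3P[].
by rewrite step H1 H2 H3.
Qed.

Lemma card_cocycle : #|{: cocycle}| = (\prod_e #|k| ^ (d1 (tl e) * d2 (hd e)))%N.
Proof.
rewrite -cardsT -[RHS](eq_bigr _ (fun e _ => card_mx _ _ _)).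
rewrite -(card_dffun_forall (fun e => predT)); apply: eq_card => g.
by rewrite !inE; apply/esym/forallP.
Qed.

Lemma card_vmaps : #|{: vmaps k d1 d2}| = (\prod_v #|k| ^ (d1 v * d2 v))%N.
Proof.
rewrite -cardsT -[RHS](eq_bigr _ (fun e _ => card_mx _ _ _)).
rewrite -(card_dffun_forall (fun e => predT)); apply: eq_card => g.
by rewrite !inE; apply/esym/forallP.
Qed.

(** The pairs (c, h) such that the graph of h over N is stable under E_c are
    counted twice.  For fixed h, the c in question form a translate of the
    cocycles sending N.1 into N.2; for a fixed stable graph, the h in question
    form a translate of the maps sending N.1 into N.2.  The statement avoids
    division: the products of powers of #|k| are the indices of these two spaces
    in all cocycles and in all vertexwise maps, and their quotient is the value
    of the Euler form. *)
Lemma card_subrep_type U V N :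
    is_subrep U N.1 -> is_subrep V N.2 ->
  (#|[set cN : cocycle * vmaps k d12 d12 |
       is_subrep (ext_rep U V cN.1) cN.2 && (graph_type cN.2 == N)]|
   * \prod_e #|k| ^ (\rank (N.1 (tl e)) * (d2 (hd e) - \rank (N.2 (hd e)))) =
   #|{: cocycle}| * \prod_v #|k| ^ (\rank (N.1 v) * (d2 v - \rank (N.2 v))))%N.
Proof.
move=> N1U N2V.
have N1K v : <<N.1 v>>%MS = N.1 v by case/andP: N1U => /forallP/(_ v)/eqP.
have N2K v : <<N.2 v>>%MS = N.2 v by case/andP: N2V => /forallP/(_ v)/eqP.
set P := [set cN | _].
pose ch := [set x : cocycle * vmaps k d1 d2 |
  is_subrep (ext_rep U V x.1) (graph_sub N x.2)].
pose qv := (\prod_v #|k| ^ (\rank (N.1 v) * (d2 v - \rank (N.2 v))))%N.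
pose qe := (\prod_e
  #|k| ^ (\rank (N.1 (tl e)) * (d2 (hd e) - \rank (N.2 (hd e)))))%N.
rewrite -/qv -/qe.
pose sv := (\prod_v #|[pred x : 'M_(_, _) | (N.1 v *m (x - 0) <= N.2 v)%MS]|)%N.
pose se := (\prod_e
  #|[pred x : 'M_(_, _) | (N.1 (tl e) *m (x - 0) <= N.2 (hd e))%MS]|)%N.
have svE : (sv * qv = #|{: vmaps k d1 d2}|)%N.
  rewrite card_vmaps -big_split; apply: eq_bigr => v _ /=.
  by rewrite card_mx_le_shift.
have seE : (se * qe = #|{: cocycle}|)%N.
  rewrite card_cocycle -big_split; apply: eq_bigr => e _ /=.
  by rewrite card_mx_le_shift.
have shift_card m n p r (A : 'M[k]_(m, n)) (B : 'M[k]_(p, r)) (x0 : 'M_(n, r)) :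
    #|[pred x : 'M[k]_(n, r) | (A *m (x - x0) <= B)%MS]| =
    #|[pred x : 'M[k]_(n, r) | (A *m (x - 0) <= B)%MS]|.
  apply/eqP; rewrite -(@eqn_pmul2r (#|k| ^ (\rank A * (r - \rank B)))).
    by rewrite !card_mx_le_shift.
  by rewrite expn_gt0; apply/orP; left; apply/card_gt0P; exists 0.
have ch1 : #|ch| = (#|{: vmaps k d1 d2}| * se)%N.
  rewrite -[X in (X * _)%N]cardsT.
  apply: (card_fibers (f := snd)) => [x _|h _]; first by rewrite inE.
  have -> : se = (\prod_e
      #|[pred x | (N.1 (tl e) *m (x - cobound U V h e) <= N.2 (hd e))%MS]|)%N.
    by apply: eq_bigr => e _; apply/esym/shift_card.
  rewrite -(card_dffun_forall (fun e x =>
    (N.1 (tl e) *m (x - cobound U V h e) <= N.2 (hd e))%MS)).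
  have pairI : injective (fun c : cocycle => (c, h)) by move=> ? ? [].
  rewrite -[RHS](card_imset _ pairI).
  apply: eq_card => -[c h']; rewrite !inE /=.
  apply/andP/imsetP => [[+ /eqP E] | [c' + [-> ->]]].
    subst h'.
    by rewrite is_subrep_graph // => /and3P[_ _ H]; exists c; rewrite // inE.
  by rewrite inE is_subrep_graph // N1U N2V => ->.
have ch2 : #|ch| = (#|P| * sv)%N.
  apply: (card_fibers (f := fun x => (x.1, graph_sub N x.2)))
    => [[c h] | [c N']].
    by rewrite !inE /= => ->; rewrite graph_type_graph // eqxx.
  rewrite inE /= => /andP[N'E /eqP N'N].
  have [v|h0 h0E] := @graph_sub_surj N'.
    by case/andP: N'E => /forallP/(_ v)/eqP.
  rewrite N'N in h0E; subst N'.
  have -> : sv = (\prod_v #|[pred x | (N.1 v *m (x - h0 v) <= N.2 v)%MS]|)%N.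
    by apply: eq_bigr => v _; apply/esym/shift_card.
  rewrite -(card_dffun_forall (fun v x => (N.1 v *m (x - h0 v) <= N.2 v)%MS)).
  have pairI : injective (fun h : vmaps k d1 d2 => (c, h)) by move=> ? ? [].
  rewrite -[RHS](card_imset _ pairI).
  apply: eq_card => -[c' h]; rewrite !inE /=.
  apply/andP/imsetP => [[_ /eqP[-> E]] | [h' + [-> ->]]].
    exists h => //; rewrite inE; apply/forallP => v; rewrite -graph_eq.
    by have /ffunP/(_ v) := E; rewrite !ffunE => ->.
  rewrite inE => /forallP H; have -> : graph_sub N h' = graph_sub N h0.
    by apply/ffunP => v; rewrite !ffunE; apply/eqP; rewrite graph_eq.
  by rewrite N'E eqxx.
have : (#|P| * sv * qe * qv = #|{: cocycle}| * qv * sv * qv)%N.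
  by rewrite -ch2 ch1 -seE -svE; ring.
have sv0 : (0 < sv * qv)%N.
  by rewrite svE; apply/card_gt0P; exists [ffun v => 0].
move=> E; apply/eqP; rewrite -(eqn_pmul2r sv0); apply/eqP; rewrite !mulnA.
by rewrite -[LHS]mulnAC -E; ring.
Qed.

End Extensions.

(** * Isomorphisms and automorphism groups *)

Section Isoms.
Variables (k : finFieldType) (Q : quiver).
Implicit Types d : vert Q -> nat.

Definition isoms d1 d2 (M : rep k Q d1) (N : rep k Q d2) : {set vmaps k d1 d2} :=
  [set g | is_iso M N g].

Lemma is_homP d1 d2 (M : rep k Q d1) (N : rep k Q d2) (g : vmaps k d1 d2) :
  reflect (forall e, M e *m g (hd e) = g (tl e) *m N e) (is_hom M N g).
Proof. exact: 'forall_eqP. Qed.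

Lemma is_iso_inv d1 d2 (M : rep k Q d1) (N : rep k Q d2) g :
  is_iso M N g -> exists2 g' : vmaps k d2 d1, is_iso N M g' &
    (forall v, g v *m g' v = 1%:M) /\ (forall v, g' v *m g v = 1%:M).
Proof.
case/andP => /is_homP gM /forallP gb.
have gV v : g v *m pinvmx (g v) = 1%:M by have /andP[? ?] := gb v; rewrite mulmxVp.
have Vg v : pinvmx (g v) *m g v = 1%:M by have /andP[? ?] := gb v; rewrite mulVpmx.
exists [ffun v => pinvmx (g v)]; last by split=> v; rewrite ffunE.
apply/andP; split.
  apply/is_homP => e; rewrite !ffunE.
  rewrite -[LHS]mul1mx -(Vg (tl e)) -mulmxA; congr (_ *m _).
  by rewrite mulmxA -gM -mulmxA gV mulmx1.
apply/forallP => v; rewrite ffunE; apply/andP; split.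
  by apply/row_freeP; exists (g v).
by apply/row_fullP; exists (g v).
Qed.

Lemma is_iso_comp d1 d2 d3 (M : rep k Q d1) (N : rep k Q d2) (P : rep k Q d3) g h :
  is_iso M N g -> is_iso N P h -> is_iso M P [ffun v => g v *m h v].
Proof.
case/andP => /is_homP gM /forallP gb; case/andP => /is_homP hM /forallP hb.
apply/andP; split.
  by apply/is_homP => e; rewrite !ffunE mulmxA gM -!mulmxA hM.
apply/forallP => v; rewrite ffunE.
have /andP[/row_freeP[g1 g1K] /row_fullP[g2 g2K]] := gb v.
have /andP[/row_freeP[h1 h1K] /row_fullP[h2 h2K]] := hb v.
apply/andP; split.
  by apply/row_freeP; exists (h1 *m g1); rewrite mulmxA -(mulmxA (g v)) h1K mulmx1.
by apply/row_fullP; exists (h2 *m g2); rewrite mulmxA -(mulmxA h2) g2K mulmx1.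
Qed.

Lemma leq_card_isoms d1 d2 d3 (M : rep k Q d1) (N : rep k Q d2) (P : rep k Q d3) :
  iso N P -> (#|isoms M N| <= #|isoms M P|)%N.
Proof.
case/existsP => h hNP; have [h' _ [hh' _]] := is_iso_inv hNP.
pose f (g : vmaps k d1 d2) : vmaps k d1 d3 := [ffun v => g v *m h v].
have fI : injective f.
  move=> g1 g2 /ffunP E; apply/ffunP => v; have := congr1 (mulmx^~ (h' v)) (E v).
  by rewrite !ffunE -!mulmxA hh' !mulmx1.
rewrite -(card_imset _ fI) subset_leq_card //; apply/subsetP => _ /imsetP[g + ->].
by rewrite !inE => /is_iso_comp; apply.
Qed.

Lemma leq_card_isomsl d1 d2 d3 (M : rep k Q d1) (N : rep k Q d2) (P : rep k Q d3) :
  iso M N -> (#|isoms N P| <= #|isoms M P|)%N.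
Proof.
case/existsP => h hMN; have [h' _ [_ hh']] := is_iso_inv hMN.
pose f (g : vmaps k d2 d3) : vmaps k d1 d3 := [ffun v => h v *m g v].
have fI : injective f.
  move=> g1 g2 /ffunP E; apply/ffunP => v; have := congr1 (mulmx (h' v)) (E v).
  by rewrite !ffunE !mulmxA hh' !mul1mx.
rewrite -(card_imset _ fI) subset_leq_card //; apply/subsetP => _ /imsetP[g + ->].
by rewrite !inE; apply: is_iso_comp.
Qed.

Lemma card_isoms_cod d1 d2 (M : rep k Q d1) (N : rep k Q d2) :
  iso M N -> #|isoms M N| = aut_card N.
Proof.
move=> MN; apply/eqP; rewrite eqn_leq (leq_card_isomsl N (iso_sym_imp MN)).
by rewrite leq_card_isomsl.
Qed.

Lemma card_isoms_dom d1 d2 (M : rep k Q d1) (N : rep k Q d2) :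
  iso M N -> #|isoms M N| = aut_card M.
Proof.
move=> MN; apply/eqP; rewrite eqn_leq (leq_card_isoms M (iso_sym_imp MN)).
by rewrite leq_card_isoms.
Qed.

Lemma aut_card_iso d1 d2 (M : rep k Q d1) (N : rep k Q d2) :
  iso M N -> aut_card M = aut_card N.
Proof. by move=> MN; rewrite -(card_isoms_dom MN) card_isoms_cod. Qed.

Lemma aut_card_gt0 d (M : rep k Q d) : (0 < aut_card M)%N.
Proof.
by have /existsP[g gM] := iso_refl M; apply/card_gt0P; exists g; rewrite inE.
Qed.

Lemma iso_dim d1 d2 (M : rep k Q d1) (N : rep k Q d2) : iso M N -> d1 =1 d2.
Proof.
case/existsP => g /andP[_ /forallP gb] v; have /andP[/eqP gF] := gb v.
by rewrite /row_full gF => /eqP.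
Qed.

End Isoms.

(** * Short exact sequences and Hall numbers *)

Section ShortExact.
Variables (k : finFieldType) (Q : quiver).
Implicit Types d : vert Q -> nat.

Definition is_ses d1 d2 d (U : rep k Q d1) (V : rep k Q d2) (W : rep k Q d)
    (x : vmaps k d2 d * vmaps k d d1) : bool :=
  [&& is_hom V W x.1, is_hom W U x.2
    & [forall v, [&& row_free (x.1 v), row_full (x.2 v)
                   & (x.1 v == kermx (x.2 v))%MS]]].

Lemma is_sesP d1 d2 d (U : rep k Q d1) (V : rep k Q d2) (W : rep k Q d) i p :
  reflect [/\ is_hom V W i, is_hom W U p, forall v, row_free (i v),
      forall v, row_full (p v) & forall v, (i v :=: kermx (p v))%MS]
    (is_ses U V W (i, p)).
Proof.
apply: (iffP and3P) => [[Vi Up /forallP H]|[Vi Up iF pF ip]]; split => //.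
- by move=> v; case/and3P: (H v).
- by move=> v; case/and3P: (H v).
- by move=> v; case/and3P: (H v) => _ _ /eqmxP.
by apply/forallP => v; rewrite iF pF; apply/eqmxP.
Qed.

Lemma subquo_ses d (W : rep k Q d) N : is_subrep W N ->
  exists2 x, is_ses (quorep W N) (subrep W N) W x & forall v, (x.1 v :=: N v)%MS.
Proof.
case/andP => _ /forallP NW.
pose vs : vmaps k (fun v => \rank (N v)) d :=
  [ffun v => val_submod (U := N v) 1%:M].
pose q : vmaps k d (fun v => \rank (cokermx (N v))) :=
  [ffun v => in_factmod (N v) 1%:M].
have vsN v : (vs v :=: N v)%MS by rewrite ffunE; apply: val_submod1.
have q0 v m (Y : 'M_(m, d v)) : (Y *m q v == 0) = (Y <= N v)%MS.
  by rewrite ffunE -in_factmodE in_factmod_eq0.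
exists (vs, q) => //; apply/is_sesP; split.
- apply/is_homP => e; rewrite [subrep _ _ _]ffunE.
  rewrite [vs (hd e)]ffunE -val_submodE in_submodK.
    by rewrite [vs (tl e)]ffunE.
  by rewrite (submx_trans _ (NW e)) // submxMr // val_submod1.
- apply/is_homP => e; rewrite [quorep _ _ _]ffunE in_factmodE.
  have : val_factmod (U := N (tl e)) 1%:M *m q (tl e) = 1%:M.
    by rewrite ffunE -in_factmodE val_factmodK.
  move: (val_factmod _) => vf vfq.
  have qE : in_factmod (N (hd e)) 1%:M = q (hd e) by rewrite ffunE.
  rewrite qE !mulmxA; apply/eqP; rewrite -subr_eq0 -{1}[W e]mul1mx -!mulmxBl.
  rewrite q0 (submx_trans _ (NW e)) // submxMr // -q0 mulmxBl mul1mx -mulmxA.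
  by rewrite vfq mulmx1 subrr.
- move=> v; apply/row_freeP; exists (in_submod (N v) 1%:M).
  by rewrite ffunE -in_submodE val_submodK.
- move=> v; apply/row_fullP; exists (val_factmod (U := N v) 1%:M).
  by rewrite ffunE -in_factmodE val_factmodK.
move=> v; apply: eqmx_trans (vsN v) _; apply/eqmxP/andP; split.
  by rewrite sub_kermx q0.
by rewrite -q0 mulmx_ker.
Qed.

(** Once the image of the first map is fixed, a short exact sequence is the same
    as a pair of isomorphisms, onto the given subobject and from the given
    quotient: factor its maps through those of the fixed sequence x0. *)
Lemma card_ses_fiber d1 d2 d3 d4 d (U : rep k Q d1) (V : rep k Q d2)
    (U0 : rep k Q d3) (V0 : rep k Q d4) (W : rep k Q d) x0 :
  is_ses U0 V0 W x0 ->
  #|[set x | is_ses U V W x & [forall v, (x.1 v == x0.1 v)%MS]]| =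
  (#|isoms V V0| * #|isoms U0 U|)%N.
Proof.
case: x0 => i0 p0 /is_sesP[/is_homP Vi0 /is_homP Up0 i0F p0F ip0].
pose f (y : vmaps k d2 d4 * vmaps k d3 d1) : vmaps k d2 d * vmaps k d d1 :=
  ([ffun v => y.1 v *m i0 v], [ffun v => p0 v *m y.2 v]).
have fI : injective f.
  case=> [a b] [a' b'] [/ffunP Ea /ffunP Eb]; congr pair; apply/ffunP => v.
    by have := Ea v; rewrite !ffunE => /(row_free_inj (i0F v)).
  by have := Eb v; rewrite !ffunE => /(row_full_inj (p0F v)).
rewrite -cardsX -(card_imset _ fI); apply: eq_card => -[i p].
rewrite inE; apply/andP/imsetP => [[sx /forallP ii0] | [[a b]]].
  have /is_sesP[/is_homP Vi /is_homP Up iF pF ip] := sx.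
  have [a aE] : exists a : vmaps k d2 d4, forall v, a v *m i0 v = i v.
    exists [ffun v => i v *m pinvmx (i0 v)] => v.
    by rewrite ffunE mulmxKpV // (eqmxP (ii0 v)).
  have [a' a'E] : exists a' : vmaps k d4 d2, forall v, a' v *m i v = i0 v.
    exists [ffun v => i0 v *m pinvmx (i v)] => v.
    by rewrite ffunE mulmxKpV // (eqmxP (ii0 v)).
  have quoE m n1 n2 (q : 'M[k]_(m, n1)) (q' : 'M[k]_(m, n2)) :
      row_full q -> (kermx q <= kermx q')%MS -> q *m (pinvmx q *m q') = q'.
    move=> qF /sub_kermxP qq'; apply/eqP.
    rewrite -subr_eq0 -{2}[q']mul1mx mulmxA -mulmxBl -sub_kermx.
    apply: (submx_trans (B := kermx q)); last exact/sub_kermxP.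
    by rewrite sub_kermx mulmxBl mul1mx -mulmxA mulVpmx // mulmx1 subrr.
  have [b bE] : exists b : vmaps k d3 d1, forall v, p0 v *m b v = p v.
    exists [ffun v => pinvmx (p0 v) *m p v] => v; rewrite ffunE.
    by apply: quoE => //; rewrite -ip -ip0 (eqmxP (ii0 v)).
  have [b' b'E] : exists b' : vmaps k d1 d3, forall v, p v *m b' v = p0 v.
    exists [ffun v => pinvmx (p v) *m p0 v] => v; rewrite ffunE.
    by apply: quoE => //; rewrite -ip -ip0 (eqmxP (ii0 v)).
  exists (a, b); last by congr pair; apply/ffunP => v; rewrite !ffunE /= ?aE ?bE.
  rewrite !inE; apply/andP; split; apply/andP; split.
  - apply/is_homP => e; apply: (row_free_inj (i0F _)).
    by rewrite -!mulmxA Vi0 aE mulmxA aE Vi.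
  - apply/forallP => v.
    apply/andP; split; [apply/row_freeP|apply/row_fullP]; exists (a' v).
      by apply: (row_free_inj (iF v)); rewrite -mulmxA a'E aE mul1mx.
    by apply: (row_free_inj (i0F v)); rewrite -mulmxA aE a'E mul1mx.
  - apply/is_homP => e; apply: (row_full_inj (p0F _)).
    by rewrite /= !mulmxA bE -Up0 -mulmxA bE Up.
  - apply/forallP => v.
    apply/andP; split; [apply/row_freeP|apply/row_fullP]; exists (b' v).
      by apply: (row_full_inj (p0F v)); rewrite mulmxA bE b'E mulmx1.
    by apply: (row_full_inj (pF v)); rewrite mulmxA b'E bE mulmx1.
rewrite !inE /= => /andP[aI bI] [-> ->].
have [a' _ [aa' a'a]] := is_iso_inv aI; have [b' _ [bb' b'b]] := is_iso_inv bI.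
case/andP: aI bI => /is_homP aH _ /andP[/is_homP bH _]; split; last first.
  apply/forallP => v; rewrite ffunE submxMl /=; apply/submxP; exists (a' v).
  by rewrite mulmxA a'a mul1mx.
apply/is_sesP; split.
- by apply/is_homP => e; rewrite !ffunE mulmxA aH -!mulmxA Vi0.
- by apply/is_homP => e; rewrite !ffunE mulmxA Up0 -!mulmxA bH.
- move=> v; rewrite ffunE; have /row_freeP[j jE] := i0F v; apply/row_freeP.
  by exists (j *m a' v); rewrite mulmxA -(mulmxA (a v)) jE mulmx1.
- move=> v; rewrite ffunE; have /row_fullP[j jE] := p0F v; apply/row_fullP.
  by exists (b' v *m j); rewrite mulmxA -(mulmxA (b' v)) jE mulmx1.
move=> v; rewrite !ffunE; apply/eqmxP/andP; split.
  apply/sub_kermxP; rewrite mulmxA -(mulmxA (a v)).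
  have -> : i0 v *m p0 v = 0 by apply/sub_kermxP; rewrite ip0.
  by rewrite mulmx0 mul0mx.
apply: (submx_trans (B := i0 v)).
  rewrite ip0; apply/sub_kermxP.
  rewrite -[LHS]mulmx1 -(bb' v) mulmxA -(mulmxA _ (p0 v)).
  by rewrite mulmx_ker mul0mx.
by apply/submxP; exists (a' v); rewrite mulmxA a'a mul1mx.
Qed.

(** Sort the short exact sequences by the image of their first map. *)
Lemma card_ses d1 d2 d (U : rep k Q d1) (V : rep k Q d2) (W : rep k Q d) :
  #|[set x | is_ses U V W x]| = (hall_num U V W * (aut_card V * aut_card U))%N.
Proof.
pose f (x : vmaps k d2 d * vmaps k d d1) : vmaps k d d :=
  [ffun v => <<x.1 v>>%MS].
apply: (card_fibers (f := f)) => [x|N].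
  rewrite inE => sx; have sN : is_subrep W (f x).
    case: x @f sx => i p /= /is_sesP[/is_homP Vi _ _ _ _]; apply/andP; split.
      by apply/forallP => v; rewrite ffunE genmx_id.
    apply/forallP => e.
    by rewrite !ffunE /= (eqmxMr _ (genmxE _)) genmxE -Vi submxMl.
  have [x0 sx0 x0N] := subquo_ses sN.
  have : (0 < #|isoms V (subrep W (f x))| * #|isoms (quorep W (f x)) U|)%N.
    rewrite -(card_ses_fiber _ _ sx0); apply/card_gt0P; exists x; rewrite inE sx /=.
    have fE v : (f x v :=: x.1 v)%MS by rewrite ffunE; apply: genmxE.
    by apply/forallP => v; rewrite !x0N !fE submx_refl.
  (* The fibre over f x contains x, so both sets of isomorphisms are inhabited. *)
  rewrite muln_gt0 => /andP[/card_gt0P[a +] /card_gt0P[b]]; rewrite !inE => aI bI.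
  rewrite sN /=; apply/andP; split; last by apply/existsP; exists b.
  by apply/iso_sym_imp/existsP; exists a.
rewrite [N \in _]inE => /and3P[NW NV NU].
have [x0 sx0 x0N] := subquo_ses NW.
rewrite -(card_isoms_dom (iso_sym_imp NV)) -(card_isoms_cod NU).
rewrite -(card_ses_fiber _ _ sx0); apply: eq_card => x.
rewrite !inE; congr andb; apply/eqP/forallP => [fx v | H].
  have fE : (f x v :=: x.1 v)%MS by rewrite ffunE; apply: genmxE.
  by rewrite !x0N -[in X in _ && X]fE -[in X in X && _]fE fx submx_refl.
apply/ffunP => v; rewrite ffunE.
have /andP[/forallP/(_ v)/eqP <- _] := NW; apply/eq_genmx.
by apply: eqmx_trans (x0N v); apply/eqmxP.
Qed.

End ShortExact.

(** * Riedtmann's formula *)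

Section Riedtmann.
Variables (k : finFieldType) (Q : quiver) (d1 d2 : vert Q -> nat).
Variables (U : rep k Q d1) (V : rep k Q d2).
Local Notation d12 := (fun v => d1 v + d2 v)%N.
Local Notation E := (ext_rep U V).
Local Notation emb v := (row_mx 0 1%:M : 'M[k]_(d2 v, d1 v + d2 v)).
Local Notation prj v := (col_mx 1%:M 0 : 'M[k]_(d1 v + d2 v, d1 v)).
Implicit Types (d : vert Q -> nat) (c : cocycle k d1 d2) (h : vmaps k d1 d2).

Definition unip h : vmaps k d12 d12 := [ffun v => block_mx 1%:M (h v) 0 1%:M].

Lemma is_iso_unip c c' h :
  is_iso (E c) (E c') (unip h) = [forall e, c' e == c e + cobound U V h e].
Proof.
rewrite /is_iso andbC.
have -> /= : [forall v, row_free (unip h v) && row_full (unip h v)].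
  apply/forallP => v; rewrite row_free_unit row_full_unit unitmxE ffunE.
  by rewrite det_ublock !det1 mulr1 unitr1.
apply: eq_forallb => e; rewrite !ffunE !mulmx_block !mulmx0 !mul0mx !mulmx1 !mul1mx.
rewrite !addr0 !add0r; apply/eqP/eqP => [/eq_block_mx[_ + _ _] | ->].
  by rewrite /cobound addrA [c e + _]addrC => ->; rewrite addrK.
by congr block_mx; rewrite /cobound addrA subrK addrC.
Qed.

(** The map g : E_c -> W identifies the standard sequence V -> E_c -> U with the
    sequence x. *)
Definition adapted d (g : vmaps k d12 d) (x : vmaps k d2 d * vmaps k d d1) : bool :=
  [forall v, (emb v *m g v == x.1 v) && (g v *m x.2 v == prj v)].

Lemma adaptedP d (g : vmaps k d12 d) (i : vmaps k d2 d) (p : vmaps k d d1) :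
  reflect ((forall v, emb v *m g v = i v) /\ (forall v, g v *m p v = prj v))
    (adapted g (i, p)).
Proof.
apply: (iffP forallP) => [H | [Hi Hp] v].
  by split=> v; have /andP[/eqP ? /eqP ?] := H v.
by rewrite Hi Hp !eqxx.
Qed.

Lemma unip_adapted (g : vmaps k d12 d12) :
    (forall v, emb v *m g v = emb v) -> (forall v, g v *m prj v = prj v) ->
  exists h, g = unip h.
Proof.
move=> gi gp; exists [ffun v => ursubmx (g v : 'M_(d1 v + d2 v, d1 v + d2 v))].
apply/ffunP => v; rewrite !ffunE.
have := gi v; have := gp v; rewrite -{1 2 3}[g v]submxK.
rewrite mul_row_block !mul0mx !mul1mx !add0r => ggp /eq_row_mx[-> ->].
move: ggp; rewrite mul_block_col !mulmx0 !mulmx1 !addr0 => /eq_col_mx[-> _].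
by [].
Qed.

Lemma iso_adapted_ses d (W : rep k Q d) c g x :
  is_iso (E c) W g -> adapted g x -> is_ses U V W x.
Proof.
case: x => i p gI /adaptedP[gi gp]; have [/is_homP gH _] := andP gI.
have [g' /andP[/is_homP g'H _] [gg' g'g]] := is_iso_inv gI.
have iE v : i v *m g' v = emb v by rewrite -gi -mulmxA gg' mulmx1.
have pE v : g' v *m prj v = p v by rewrite -gp mulmxA g'g mul1mx.
apply/is_sesP; split.
- apply/is_homP => e; rewrite -!gi -mulmxA -gH !mulmxA; congr mulmx.
  by rewrite ffunE mul_row_block mul_mx_row !mulmx1 !mulmx0 !mul0mx mul1mx !add0r.
- apply/is_homP => e; rewrite -!pE mulmxA g'H -!mulmxA; congr mulmx.
  by rewrite ffunE mul_block_col mul_col_mx !mulmx1 !mulmx0 !mul0mx mul1mx !addr0.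
- move=> v; apply/row_freeP; exists (g' v *m col_mx 0 1%:M).
  by rewrite mulmxA iE mul_row_col mulmx1 mul0mx add0r.
- move=> v; apply/row_fullP; exists (row_mx 1%:M 0 *m g v).
  by rewrite -mulmxA gp mul_row_col mulmx1 mul0mx addr0.
move=> v; apply/eqmxP/andP; split.
  by apply/sub_kermxP; rewrite -gi -mulmxA gp mul_row_col mulmx0 mul0mx addr0.
apply/rV_subP => y /sub_kermxP; rewrite -pE mulmxA => y0.
apply/submxP; exists (y *m g' v *m col_mx 0 1%:M).
rewrite -gi -[y in LHS]mulmx1 -g'g !mulmxA; congr (_ *m _).
move: y0; rewrite -{1 2 3}[y *m _]hsubmxK !mul_row_col !mulmx0 !mulmx1.
rewrite addr0 add0r => ->.
by rewrite mul_mx_row mulmx0 mulmx1.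
Qed.

Lemma ses_split n n1 n2 (i : 'M[k]_(n2, n)) (p : 'M[k]_(n, n1)) :
    row_free i -> row_full p -> (i :=: kermx p)%MS ->
  exists2 s : 'M[k]_(n1, n), s *m p = 1%:M &
    row_free (col_mx s i) && row_full (col_mx s i).
Proof.
move=> /row_freeP[r ir] /row_fullP[s sp] ip; exists s => //.
have ip0 : i *m p = 0 by apply/sub_kermxP; rewrite ip.
have /submxP[t tE] : (1%:M - p *m s <= i)%MS.
  by rewrite ip sub_kermx mulmxBl mul1mx -mulmxA sp mulmx1 subrr.
have full : row_mx p t *m col_mx s i = 1%:M by rewrite mul_row_col -tE addrC subrK.
apply/andP; split; last by apply/row_fullP; exists (row_mx p t).
apply/row_freeP; exists (row_mx p t).
have st : s *m t = 0.
  have : s *m t *m i = 0.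
    by rewrite -mulmxA -tE mulmxBr mulmx1 mulmxA sp mul1mx subrr.
  by move/(congr1 (mulmx^~ r)); rewrite /= -[LHS]mulmxA ir mulmx1 mul0mx.
have it : i *m t = 1%:M.
  have : i *m t *m i = i.
    by rewrite -mulmxA -tE mulmxBr mulmx1 mulmxA ip0 mul0mx subr0.
  by move/(congr1 (mulmx^~ r)); rewrite /= -[LHS]mulmxA ir mulmx1.
by rewrite mul_col_row sp st ip0 it -scalar_mx_block.
Qed.

(** Split the sequence by linear sections s of its second map, which need not
    commute with the arrows; c measures by how much they fail to. *)
Lemma ses_adapted d (W : rep k Q d) x :
  is_ses U V W x -> exists c g, is_iso (E c) W g /\ adapted g x.
Proof.
case: x => i p /is_sesP[/is_homP Vi /is_homP Up iF pF ip].
have /fin_all_exists2[s sp sI] v := ses_split (iF v) (pF v) (ip v).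
have /fin_all_exists[c cE] e : exists c : 'M_(d1 (tl e), d2 (hd e)),
    s (tl e) *m W e - U e *m s (hd e) = c *m i (hd e).
  apply/submxP; rewrite ip sub_kermx mulmxBl -!mulmxA Up sp mulmx1 mulmxA sp.
  by rewrite mul1mx subrr.
exists [ffun e => c e], [ffun v => col_mx (s v) (i v)]; split; last first.
  apply/adaptedP; split=> v; rewrite ffunE.
    by rewrite mul_row_col mul0mx mul1mx add0r.
  by rewrite mul_col_mx sp; congr col_mx; apply/sub_kermxP; rewrite ip.
apply/andP; split; last by apply/forallP => v; rewrite ffunE.
apply/is_homP => e; rewrite !ffunE mul_block_col mul_col_mx mul0mx add0r Vi.
by congr col_mx; rewrite -cE addrC subrK.
Qed.

(** Two isomorphisms inducing the same sequence differ by an automorphism of the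
    standard sequence, which is unitriangular. *)
Lemma is_iso_adapted_unip d (W : rep k Q d) c c0 g g0 x :
    is_iso (E c) W g -> adapted g x -> is_iso (E c0) W g0 -> adapted g0 x ->
  exists2 h, is_iso (E c) (E c0) (unip h) &
    g = [ffun v => unip h v *m g0 v].
Proof.
case: x => i p gI /adaptedP[gi gp] g0I /adaptedP[g0i g0p].
have [g' g'I [gg' g'g]] := is_iso_inv g0I.
have compI := is_iso_comp gI g'I.
have [v|v|h hE] := @unip_adapted [ffun v => g v *m g' v].
- by rewrite ffunE mulmxA gi -g0i -mulmxA gg' mulmx1.
- by rewrite ffunE -(g0p v) -mulmxA (mulmxA (g' v)) g'g mul1mx gp g0p.
exists h; first by rewrite -hE.
by rewrite -hE; apply/ffunP => v; rewrite !ffunE -mulmxA g'g mulmx1.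
Qed.

Lemma card_adapted d (W : rep k Q d) x : is_ses U V W x ->
  #|[set cg : cocycle k d1 d2 * vmaps k d12 d |
      is_iso (E cg.1) W cg.2 && adapted cg.2 x]| = #|{: vmaps k d1 d2}|.
Proof.
move=> sx; have [c0 [g0 [g0I g0x]]] := ses_adapted sx.
pose f h : cocycle k d1 d2 * vmaps k d12 d :=
  ([ffun e => c0 e - cobound U V h e], [ffun v => unip h v *m g0 v]).
have [g0' _ [g0K _]] := is_iso_inv g0I.
have fI : injective f.
  move=> h h' [_ /ffunP E]; apply/ffunP => v.
  have := congr1 (mulmx^~ (g0' v)) (E v); rewrite !ffunE -!mulmxA g0K !mulmx1.
  by case/eq_block_mx.
rewrite -cardsT -[RHS](card_imset _ fI); apply: eq_card => -[c g].
rewrite inE /=; apply/andP/imsetP => [[gI gx] | [h _ [-> ->]]] /=.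
  have [h] := is_iso_adapted_unip gI gx g0I g0x.
  rewrite is_iso_unip => /forallP ch ->; exists h => //; congr pair.
  by apply/ffunP => e; rewrite ffunE (eqP (ch e)) addrK.
split.
  apply: is_iso_comp g0I; rewrite is_iso_unip; apply/forallP => e.
  by rewrite ffunE subrK.
case: x g0x {sx} => i p /adaptedP[gi gp]; apply/adaptedP; split=> v.
  by rewrite !ffunE mulmxA mul_row_block !mul0mx !mul1mx !add0r.
by rewrite !ffunE -mulmxA gp mul_block_col !mulmx1 !mulmx0 !addr0.
Qed.

(** Count the pairs (c, isomorphism E_c -> W) by c and by the sequence that they
    induce on W. *)
Lemma riedtmann d (W : rep k Q d) :
  (hall_num U V W * (aut_card V * aut_card U) * #|{: vmaps k d1 d2}| =
   #|[set c | iso (E c) W]| * aut_card W)%N.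
Proof.
pose T := [set cg : cocycle k d1 d2 * vmaps k d12 d | is_iso (E cg.1) W cg.2].
rewrite -card_ses; transitivity #|T|.
  pose f (cg : cocycle k d1 d2 * vmaps k d12 d) : vmaps k d2 d * vmaps k d d1 :=
    ([ffun v => emb v *m cg.2 v], [ffun v => pinvmx (cg.2 v) *m prj v]).
  have fE cg x : cg \in T -> (f cg == x) = adapted cg.2 x.
    case: cg x => c g [i p]; rewrite inE /= => gI.
    have [_ /forallP gF] := andP gI.
    apply/eqP/adaptedP => [[<- <-] | [gi gp]].
      by split=> v; rewrite ffunE // mulmxA mulmxVp ?mul1mx //; case/andP: (gF v).
    congr pair; apply/ffunP => v; rewrite ffunE //= -gp mulmxA mulVpmx ?mul1mx //.
    by case/andP: (gF v).
  apply/esym/(card_fibers (f := f)) => [cg cgT | x].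
    rewrite inE; apply: (iso_adapted_ses (c := cg.1) (g := cg.2)).
      by rewrite inE in cgT.
    by rewrite -fE.
  rewrite inE => sx; rewrite -(card_adapted sx); apply: eq_card => cg.
  rewrite [LHS]inE [RHS]inE [cg \in T]inE.
  by case cgT: (is_iso _ _ _); rewrite //= fE // inE.
apply: (card_fibers (f := fst)) => [cg | c].
  by rewrite !inE => cgI; apply/existsP; exists cg.2.
rewrite inE => cW; rewrite -(card_isoms_cod cW).
have pairI : injective (fun g : vmaps k d12 d => (c, g)) by move=> ? ? [].
rewrite -[RHS](card_imset _ pairI).
apply: eq_card => -[c' g]; rewrite !inE /=.
apply/andP/imsetP => [[gI /eqP E] | [g' + [-> ->]]].
  by subst c'; exists g; rewrite ?inE.
by rewrite inE eqxx.
Qed.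

End Riedtmann.

(** * Extension classes as cocycles modulo coboundaries *)

Section ExtGroup.
Variables (k : finFieldType) (Q : quiver) (d1 d2 : vert Q -> nat).
Variables (U : rep k Q d1) (V : rep k Q d2).
Local Notation d12 := (fun v => d1 v + d2 v)%N.
Local Notation E := (ext_rep U V).
Implicit Types (x y z : ext_data k d1 d2) (c : cocycle k d1 d2).

Lemma ext_equivP x y :
  reflect (exists2 g, is_iso (ext_mid x) (ext_mid y) g &
      (forall v, ext_inj x v *m g v = ext_inj y v) /\
      (forall v, g v *m ext_proj y v = ext_proj x v))
    (ext_equiv x y).
Proof.
apply: (iffP existsP) => [[g /andP[gI /forallP gx]] | [g gI [gi gp]]]; exists g => //.
  by split=> v; have /andP[/eqP ? /eqP ?] := gx v.
by rewrite gI; apply/forallP => v; rewrite gi gp !eqxx.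
Qed.

Lemma ext_equiv_refl x : ext_equiv x x.
Proof.
apply/ext_equivP; exists [ffun v => 1%:M]; last first.
  by split=> v; rewrite ffunE ?mulmx1 ?mul1mx.
apply/andP; split; first by apply/is_homP => e; rewrite !ffunE mulmx1 mul1mx.
by apply/forallP => v; rewrite ffunE row_free_unit row_full_unit unitmx1.
Qed.

Lemma ext_equiv_sym x y : ext_equiv x y -> ext_equiv y x.
Proof.
case/ext_equivP => g /is_iso_inv[g' g'I [gg' g'g]] [gi gp]; apply/ext_equivP.
exists g' => //; split=> v; first by rewrite -gi -mulmxA gg' mulmx1.
by rewrite -gp mulmxA g'g mul1mx.
Qed.

Lemma ext_equiv_trans y x z : ext_equiv x y -> ext_equiv y z -> ext_equiv x z.
Proof.
case/ext_equivP => g gI [gi gp] /ext_equivP[h hI [hi hp]]; apply/ext_equivP.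
exists [ffun v => g v *m h v]; first exact: is_iso_comp gI hI.
by split=> v; rewrite ffunE; [rewrite mulmxA gi hi|rewrite -mulmxA hp gp].
Qed.

Definition ext_class x : {set ext_data k d1 d2} :=
  [set y in [set y | is_ext U V y] | ext_equiv x y].

Lemma eq_ext_class x y : is_ext U V x -> is_ext U V y ->
  (ext_class x == ext_class y) = ext_equiv x y.
Proof.
move=> xE yE; apply/eqP/idP => [xy | xy].
  have : y \in ext_class y by rewrite !inE yE ext_equiv_refl.
  by rewrite -xy !inE => /andP[].
apply/setP => z; rewrite !inE; congr andb.
by apply/idP/idP; apply: ext_equiv_trans => //; apply: ext_equiv_sym.
Qed.

Definition ext_of c : ext_data k d1 d2 :=
  (E c, [ffun v => row_mx 0 1%:M], [ffun v => col_mx 1%:M 0]).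

Lemma ext_of_adapted c (x : ext_data k d1 d2) g :
  is_iso (E c) (ext_mid x) g -> adapted g (ext_inj x, ext_proj x) ->
  ext_equiv (ext_of c) x.
Proof.
move=> gI /adaptedP[gi gp]; apply/ext_equivP; exists g => //.
by split=> v; rewrite ffunE.
Qed.

Lemma ext_of_is_ext c : is_ext U V (ext_of c).
Proof.
have /ext_equivP[g gI [gi gp]] := ext_equiv_refl (ext_of c).
apply: (iso_adapted_ses gI (x := (_, _))).
by apply/adaptedP; split=> v; [rewrite -[RHS]gi ffunE | rewrite [LHS]gp ffunE].
Qed.

Lemma ext_of_surj x : is_ext U V x -> exists c, ext_equiv (ext_of c) x.
Proof.
move=> /(ses_adapted (x := (_, _)))[c [g [gI gx]]].
by exists c; apply: ext_of_adapted gx.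
Qed.

Lemma ext_equiv_of c c' :
  ext_equiv (ext_of c) (ext_of c') =
  [exists h, [forall e, c' e == c e + cobound U V h e]].
Proof.
apply/ext_equivP/existsP => [[g gI [gi gp]] | [h]].
  have [v|v|h gE] := @unip_adapted _ _ _ _ g.
  - by have := gi v; rewrite !ffunE.
  - by have := gp v; rewrite !ffunE.
  by exists h; rewrite -is_iso_unip -gE.
rewrite -is_iso_unip => hI; exists (unip h) => //; split=> v; rewrite !ffunE.
  by rewrite mul_row_block !mul0mx !mul1mx !add0r.
by rewrite mul_block_col !mulmx1 !mulmx0 !addr0.
Qed.

Definition cobounds : {set cocycle k d1 d2} :=
  [set ([ffun e => cobound U V h e] : cocycle k d1 d2) | h : vmaps k d1 d2].

Lemma card_ext_class_fiber x : is_ext U V x ->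
  #|[set c | ext_class (ext_of c) == ext_class x]| = #|cobounds|.
Proof.
move=> xE; have [c0 c0x] := ext_of_surj xE.
have /eqP <- : ext_class (ext_of c0) == ext_class x.
  by rewrite eq_ext_class // ext_of_is_ext.
pose f (b : cocycle k d1 d2) : cocycle k d1 d2 := [ffun e => c0 e - b e].
have fI : injective f.
  move=> b b' /ffunP bE; apply/ffunP => e; have := bE e.
  by rewrite !ffunE => /addrI/oppr_inj.
rewrite -[RHS](card_imset _ fI); apply: eq_card => c.
rewrite inE eq_ext_class ?ext_of_is_ext // ext_equiv_of.
apply/existsP/imsetP => [[h /forallP hE] | [_ /imsetP[h _ ->] ->]].
  exists [ffun e => cobound U V h e]; first exact: imset_f.
  by apply/ffunP => e; rewrite !ffunE (eqP (hE e)) addrK.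
by exists h; apply/forallP => e; rewrite !ffunE subrK.
Qed.

Lemma Ext_classP s :
  reflect (exists2 x, is_ext U V x & s = ext_class x) (s \in Ext U V).
Proof.
by apply: (iffP imsetP) => -[x]; [rewrite inE|]; exists x; rewrite ?inE.
Qed.

Lemma card_Ext : #|{: cocycle k d1 d2}| = (#|Ext U V| * #|cobounds|)%N.
Proof.
rewrite -cardsT; apply: (card_fibers (f := fun c => ext_class (ext_of c))).
  by move=> c _; apply/Ext_classP; exists (ext_of c) => //; apply: ext_of_is_ext.
move=> _ /Ext_classP[x xE ->]; rewrite -(card_ext_class_fiber xE).
by apply: eq_card => c; rewrite !inE.
Qed.

Lemma ext_class_mid x d (W : rep k Q d) : is_ext U V x ->
  [exists y in ext_class x, iso (ext_mid y) W] = iso (ext_mid x) W.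
Proof.
move=> xE; apply/existsP/idP => [[y] | xW].
  rewrite !inE => /andP[/andP[_ /ext_equivP[g gI _]]]; apply: iso_trans_imp.
  by apply/existsP; exists g.
by exists x; rewrite !inE xE ext_equiv_refl.
Qed.

Lemma card_Ext_mid d (W : rep k Q d) :
  #|[set c | iso (E c) W]| = (#|Ext_mid U V W| * #|cobounds|)%N.
Proof.
apply: (card_fibers (f := fun c => ext_class (ext_of c))) => [c | s].
  rewrite inE => cW; rewrite inE ext_class_mid ?ext_of_is_ext // cW andbT.
  by apply/Ext_classP; exists (ext_of c) => //; apply: ext_of_is_ext.
rewrite inE => /andP[/Ext_classP[x xE ->]]; rewrite ext_class_mid // => xW.
rewrite -(card_ext_class_fiber xE); apply: eq_card => c; rewrite !inE.
apply: andb_idl; rewrite eq_ext_class ?ext_of_is_ext // => /ext_equivP[g gI _].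
by apply: iso_trans_imp xW; apply/existsP; exists g.
Qed.

Lemma card_cobounds_gt0 : (0 < #|cobounds|)%N.
Proof.
by apply/card_gt0P; exists [ffun e => cobound U V [ffun=> 0] e]; apply: imset_f.
Qed.

End ExtGroup.

(** * Isomorphism classes of a given dimension *)

Section GrIso.
Variables (k : finFieldType) (Q : quiver).
Implicit Types d : vert Q -> nat.

Lemma leq_card_Gr d1 d2 (M : rep k Q d1) (N : rep k Q d2) g :
  iso M N -> (#|Gr g M| <= #|Gr g N|)%N.
Proof.
case/existsP => h hI; have [h' _ [hh' h'h]] := is_iso_inv hI.
have [/is_homP hH /forallP hb] := andP hI.
pose f (L : vmaps k d1 d1) : vmaps k d2 d2 := [ffun v => <<L v *m h v>>%MS].
have fI : {in Gr g M &, injective f}.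
  move=> L L'; rewrite !inE.
  move=> /andP[/andP[/forallP LK _] _] /andP[/andP[/forallP L'K _] _].
  move=> /ffunP fE; apply/ffunP => v; rewrite -(eqP (LK v)) -(eqP (L'K v)).
  have := fE v; rewrite !ffunE => /genmxP/eqmxP E; apply: eq_genmx.
  rewrite -[L v]mulmx1 -[L' v]mulmx1 -hh' !mulmxA.
  exact: eqmxMr.
rewrite -(card_in_imset fI) subset_leq_card //.
apply/subsetP => _ /imsetP[L + ->].
rewrite !inE => /andP[/andP[LK /forallP LM] /forallP Lg].
apply/andP; split; last first.
  apply/forallP => v; rewrite ffunE genmxE mxrankMfree ?Lg //.
  by case/andP: (hb v).
apply/andP; split; first by apply/forallP => v; rewrite ffunE genmx_id.
apply/forallP => e; rewrite !ffunE (eqmxMr _ (genmxE _)) genmxE -mulmxA -hH mulmxA.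
exact: submxMr.
Qed.

Lemma card_Gr_iso d1 d2 (M : rep k Q d1) (N : rep k Q d2) g :
  iso M N -> #|Gr g M| = #|Gr g N|.
Proof.
move=> MN; apply/eqP; rewrite eqn_leq leq_card_Gr //.
by rewrite leq_card_Gr // iso_sym_imp.
Qed.

End GrIso.

Section Below.
Variable Q : quiver.
Implicit Types a b : dimvec Q.

Lemma dim_leP b a : reflect (forall v, (b v <= a v)%N) (dim_le b a).
Proof. exact: forallP. Qed.

(** Explicit enumerations turn the finitely supported sums over all dimension
    vectors into sums over sequences, to which reindexing and exchange apply directly. *)
Definition below a : seq (dimvec Q) :=
  [seq b <- undup [seq [ffun v => f v : nat]
                   | f : {ffun vert Q -> 'I_(\max_v a v).+1}]
   | dim_le b a].

Lemma uniq_below a : uniq (below a).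
Proof. by rewrite filter_uniq // undup_uniq. Qed.

Lemma mem_below b a : (b \in below a) = dim_le b a.
Proof.
rewrite mem_filter mem_undup andb_idr // => /dim_leP ba.
apply/imageP; exists [ffun v => inord (b v)] => //.
apply/ffunP => v; rewrite !ffunE inordK // ltnS.
exact: leq_trans (ba v) (leq_bigmax _).
Qed.

Lemma dim_addE a b v : (a + b) v = (a v + b v)%N.
Proof. by rewrite ffunE. Qed.

End Below.

Section Classes.
Local Open Scope quotient_scope.
Variables (k : finFieldType) (Q : quiver).
Local Notation cl := (isocl k Q).

Lemma iso_crep_iclass (d : dimvec Q) (M : rep k Q d) : iso (crep (iclass M)) M.
Proof.
pose x := Tagged (fun d : dimvec Q => rep k Q d) M.
suff : iso_any (repr (\pi_{eq_quot (@iso_any k Q)} x)) x by [].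
by apply/eqmodP; rewrite reprK.
Qed.

Lemma iclass_iso (d1 d2 : dimvec Q) (M : rep k Q d1) (N : rep k Q d2) :
  iso M N -> iclass M = iclass N.
Proof. by move=> MN; apply/eqmodP. Qed.

Lemma crepK (X : cl) : iclass (crep X) = X.
Proof.
have taggedK (u : {d : dimvec Q & rep k Q d}) : Tagged _ (tagged u) = u.
  by case: u.
by rewrite -[RHS](reprK (X : {eq_quot @iso_any k Q})) -[in RHS](taggedK (repr _)).
Qed.

Lemma iso_crep (X Y : cl) : iso (crep X) (crep Y) = (X == Y).
Proof.
apply/idP/eqP => [XY | ->]; last exact: iso_refl.
by rewrite -(crepK X) -(crepK Y); apply: iclass_iso.
Qed.

Lemma cdim_iclass (d : dimvec Q) (M : rep k Q d) : cdim (iclass M) = d.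
Proof. by apply/ffunP; apply: iso_dim (iso_crep_iclass M). Qed.

Lemma exists_crep (d : vert Q -> nat) (M : rep k Q d) :
  exists X : cl, iso M (crep X).
Proof.
(* Classes are indexed by finite functions; d equals one by extensionality. *)
have [d' dE] : exists d' : dimvec Q, d = d'.
  by exists [ffun v => d v]; apply/funext => v; rewrite ffunE.
subst d; exists (iclass M); apply: iso_sym_imp; exact: iso_crep_iclass.
Qed.

Definition classes_of (b : dimvec Q) : seq cl :=
  undup [seq iclass M | M : rep k Q b].

Lemma mem_classes X b : (X \in classes_of b) = (cdim X == b).
Proof.
rewrite mem_undup; apply/imageP/eqP => [[M _ ->] | <-]; first exact: cdim_iclass.
by exists (crep X); rewrite ?crepK.
Qed.

Lemma uniq_classes b : uniq (classes_of b).
Proof. exact: undup_uniq. Qed.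

Lemma sum_iso_classes (d : vert Q -> nat) (M : rep k Q d) b :
  (\sum_(X <- classes_of b) iso M (crep X) = [forall v, d v == b v])%N.
Proof.
have [X0 MX0] := exists_crep M.
have -> : [forall v, d v == b v] = (X0 \in classes_of b).
  rewrite mem_classes; apply/forallP/eqP => [db | <- v].
    by apply/ffunP => v; rewrite -(eqP (db v)) (iso_dim MX0).
  by rewrite (iso_dim MX0).
rewrite -(count_uniq_mem _ (uniq_classes b)) -sum1_count [RHS]big_mkcond.
apply: eq_bigr => X _.
have -> : iso M (crep X) = (X == X0); last by rewrite /=; case: eqP.
rewrite eq_sym -iso_crep; apply/idP/idP; last exact: iso_trans_imp.
exact: iso_trans_imp (iso_sym_imp MX0).
Qed.

Lemma hall_num_dim d1 d2 d (U : rep k Q d1) (V : rep k Q d2) (W : rep k Q d) :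
  hall_num U V W != 0%N -> forall v, d v = (d1 v + d2 v)%N.
Proof.
rewrite -lt0n => /card_gt0P[N]; rewrite inE => /and3P[_ /iso_dim NV /iso_dim NU] v.
by rewrite -NV -NU mxrank_coker subnK // rank_leq_col.
Qed.

(** Every subrepresentation of W belongs to the Hall number of exactly one pair of
    classes, those of its quotient and of itself. *)
Lemma sum_hall_num d (W : rep k Q d) (b g : dimvec Q) :
    (forall v, d v = (b v + g v)%N) ->
  (\sum_(X <- classes_of b) \sum_(Y <- classes_of g) hall_num (crep X) (crep Y) W
   = #|Gr g W|)%N.
Proof.
move=> dE.
transitivity (\sum_(X <- classes_of b) \sum_(Y <- classes_of g)
    \sum_(N | is_subrep W N)
      iso (subrep W N) (crep Y) * iso (quorep W N) (crep X))%N.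
  apply: eq_bigr => X _; apply: eq_bigr => Y _.
  rewrite /hall_num -sum1_card big_mkcond [RHS]big_mkcond; apply: eq_bigr => N _.
  by rewrite inE; case: is_subrep => //=; rewrite mulnb; case: (_ && _).
under eq_bigr do rewrite exchange_big; rewrite exchange_big /=.
rewrite -sum1_card big_mkcond [RHS]big_mkcond; apply: eq_bigr => N _.
rewrite inE; case: ifP => //= _.
under eq_bigr do rewrite -big_distrl /= mulnC.
rewrite -big_distrl /= !sum_iso_classes mulnb andbC.
rewrite andb_idr; first by case: (X in if X then _ else _).
have bE v : (d v - g v)%N = b v by rewrite dE addnK.
move=> /forallP H; apply/forallP => v.
by rewrite mxrank_coker (eqP (H v)) bE.
Qed.

End Classes.

(** * The mean of the Grassmannians of the E_c *)

Lemma fsbig_seq_supp (T : choiceType) (M : nmodType) (r : seq T) (A : set T)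
    (F : T -> M) :
    uniq r -> (forall x, x \in r -> A x) ->
    (forall x, A x -> x \notin r -> F x = 0) ->
  \sum_(x \in A) F x = \sum_(x <- r) F x.
Proof.
move=> rU rA F0; rewrite (fsbigE r _ rU rA F0).
rewrite big_mkcond big_seq [RHS]big_seq; apply: eq_bigr => x /rA Ax.
by rewrite ifT //; apply: mem_set.
Qed.

Lemma sum_pred1_seq (T : eqType) (M : nmodType) (r : seq T) (F : T -> M) i :
  uniq r -> \sum_(j <- r | i == j) F j = if i \in r then F i else 0.
Proof.
move=> rU; have [ir | ir] := boolP (i \in r).
  rewrite big_mkcond (bigD1_seq i) //= eqxx big1 ?addr0 // => j.
  by rewrite eq_sym => /negPf->.
rewrite big_seq_cond big1 // => j /andP[jr /eqP ij].
by rewrite ij jr in ir.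
Qed.

Section Splits.
Variable Q : quiver.
Implicit Types a b g : dimvec Q.

Definition splits a b g : seq (dimvec Q * dimvec Q) :=
  [seq gg <- [seq (g1, g2) | g1 <- below a, g2 <- below b] | gg.1 + gg.2 == g].

Lemma mem_splits a b g gg :
  (gg \in splits a b g) = [&& dim_le gg.1 a, dim_le gg.2 b & gg.1 + gg.2 == g].
Proof.
case: gg => g1 g2; rewrite mem_filter andbC andbA; congr andb.
rewrite -!mem_below; apply/allpairsP/andP => [[[x y] /= [? ? [-> ->]]] // | [? ?]].
by exists (g1, g2).
Qed.

Lemma uniq_splits a b g : uniq (splits a b g).
Proof.
by rewrite filter_uniq // allpairs_uniq ?uniq_below // => -[? ?] [? ?] _ _ [-> ->].
Qed.

End Splits.

Section Euler.
Variables (R : realType) (k : finFieldType) (Q : quiver).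
Local Notation C := R[i].
Local Notation q := (#|k|%:R : C).
Implicit Types a b g : dimvec Q.

Lemma cardk_neq0 : q != 0.
Proof. by rewrite pnatr_eq0 -lt0n; apply/card_gt0P; exists 0. Qed.

Lemma eulerE a b : euler R k a b =
  q ^+ (\sum_v a v * b v) / q ^+ (\sum_e a (tl e) * b (hd e)).
Proof.
rewrite /euler.
have -> : euler_add a b =
    (\sum_v a v * b v)%N%:Z - (\sum_e a (tl e) * b (hd e))%N%:Z.
  rewrite /euler_add !(big_morph Posz PoszD (erefl _)).
  by congr (_ - _); apply: eq_bigr => i _; rewrite PoszM.
by rewrite expfzDr ?cardk_neq0 // -exprnN.
Qed.

Lemma euler_neq0 a b : euler R k a b != 0.
Proof. by rewrite expfz_neq0 ?cardk_neq0. Qed.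

Variables (a1 a2 : dimvec Q) (U : rep k Q a1) (V : rep k Q a2).

Lemma card_cocycle_euler :
  #|{: cocycle k a1 a2}|%:R * euler R k a1 a2 = #|{: vmaps k a1 a2}|%:R :> C.
Proof.
rewrite eulerE card_cocycle card_vmaps -!expn_sum !natrX mulrCA divff ?mulr1 //.
by rewrite expf_neq0 ?cardk_neq0.
Qed.

Lemma card_subrep_type_euler (N : vmaps k a1 a1 * vmaps k a2 a2) g1 g2 :
    N.1 \in Gr g1 U -> N.2 \in Gr g2 V ->
  #|[set cN : cocycle k a1 a2 * vmaps k _ _ |
       is_subrep (ext_rep U V cN.1) cN.2 && (graph_type cN.2 == N)]|%:R =
  #|{: cocycle k a1 a2}|%:R * euler R k g1 (dim_sub a2 g2) :> C.
Proof.
rewrite !inE => /andP[N1U /forallP r1] /andP[N2V /forallP r2].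
have := card_subrep_type N1U N2V; set P := #|_|; rewrite -!expn_sum => E.
have {}E := congr1 (fun n => n%:R : C) E; rewrite /= !natrM !natrX in E.
rewrite eulerE mulrA.
apply: (canRL (mulfK _)); first by rewrite expf_neq0 ?cardk_neq0.
have -> : (\sum_e g1 (tl e) * dim_sub a2 g2 (hd e) =
   \sum_e \rank (N.1 (tl e)) * (a2 (hd e) - \rank (N.2 (hd e))))%N.
  by apply: eq_bigr => e _; rewrite ffunE (eqP (r1 _)) (eqP (r2 _)).
rewrite E; congr (_ * _ ^+ _).
by apply: eq_bigr => e _; rewrite ffunE (eqP (r1 _)) (eqP (r2 _)).
Qed.

Lemma mxrank_graph_type
    (N : vmaps k (fun v => a1 v + a2 v)%N (fun v => a1 v + a2 v)%N) v :
    (forall v, <<N v>>%MS = N v) ->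
  \rank (N v) = (\rank ((graph_type N).1 v) + \rank ((graph_type N).2 v))%N.
Proof.
move=> NK; have [h hE] := graph_sub_surj NK.
by rewrite -{1}hE ffunE mxrank_graph.
Qed.

(** Sort the pairs (c, N), N a subrepresentation of E_c, by the type of N. *)
Lemma sum_Gr_ext g :
  (\sum_c #|Gr g (ext_rep U V c)|)%:R = #|{: cocycle k a1 a2}|%:R *
   \sum_(gg <- splits a1 a2 g)
     euler R k gg.1 (dim_sub a2 gg.2) * #|Gr gg.1 U|%:R * #|Gr gg.2 V|%:R :> C.
Proof.
pose rk (N : vmaps k a1 a1 * vmaps k a2 a2) : dimvec Q * dimvec Q :=
  ([ffun v => \rank (N.1 v)], [ffun v => \rank (N.2 v)]).
pose ok N := [&& is_subrep U N.1, is_subrep V N.2 & rk N \in splits a1 a2 g].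
pose P (N : vmaps k a1 a1 * vmaps k a2 a2) :=
  [set cN : cocycle k a1 a2 * vmaps k _ _ |
    is_subrep (ext_rep U V cN.1) cN.2 && (graph_type cN.2 == N)].
pose S := [set cN : cocycle k a1 a2 * vmaps k _ _ |
  cN.2 \in Gr g (ext_rep U V cN.1)].
have rkP N gg : (N.1 \in Gr gg.1 U) && (N.2 \in Gr gg.2 V) =
    [&& is_subrep U N.1, is_subrep V N.2 & rk N == gg].
  case: gg => g1 g2; rewrite !inE andbACA -andbA; congr [&& _, _ & _].
  apply/andP/eqP => [[/forallP H1 /forallP H2] | [<- <-]].
    by congr pair; apply/ffunP => v; rewrite ffunE ?(eqP (H1 v)) ?(eqP (H2 v)).
  by split; apply/forallP => v; rewrite ffunE.
transitivity (\sum_(N | ok N) #|P N|%:R : C).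
  rewrite -natr_sum; congr (_%:R).
  transitivity #|S|.
    rewrite -sum1_card (eq_bigl (fun cN =>
      xpredT cN.1 && (cN.2 \in Gr g (ext_rep U V cN.1)))); last first.
      by move=> cN; rewrite inE.
    rewrite -(pair_big_dep xpredT (fun c N => N \in Gr g (ext_rep U V c))
      (fun _ _ => 1%N)) /=.
    by apply: eq_bigr => c _; rewrite sum1_card.
  have typeOK cN : cN \in S -> ok (graph_type cN.2).
    case: cN => c N; rewrite inE /= => /[!inE] /andP[NE /forallP Ng].
    have NK v : <<N v>>%MS = N v by have /andP[/forallP/(_ v)/eqP] := NE.
    have [h hE] := graph_sub_surj NK.
    move: NE; rewrite -{1}hE is_subrep_graph => [/and3P[U1 V2 _]|v|v]; last 2 first.
    - by rewrite ffunE genmx_id.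
    - by rewrite ffunE genmx_id.
    rewrite /ok U1 V2 mem_splits /=; apply/and3P; split.
    - by apply/dim_leP => v; rewrite ffunE rank_leq_col.
    - by apply/dim_leP => v; rewrite ffunE rank_leq_col.
    apply/eqP/ffunP => v.
    by rewrite dim_addE !ffunE -(eqP (Ng v)) mxrank_graph_type // !ffunE.
  rewrite -sum1_card (partition_big (fun cN => graph_type cN.2) ok) //=.
  apply: eq_bigr => N /and3P[N1 N2 Nr]; rewrite -sum1_card; apply: eq_bigl => -[c M].
  rewrite !inE /=; case ME: (is_subrep _ M) => //=; apply: andb_idl => /eqP MN.
  have MK v : <<M v>>%MS = M v by have /andP[/forallP/(_ v)/eqP] := ME.
  move: Nr; rewrite mem_splits => /and3P[_ _ /eqP <-].
  by apply/forallP => v; rewrite dim_addE !ffunE mxrank_graph_type // MN.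
rewrite mulr_sumr.
transitivity (\sum_(gg <- splits a1 a2 g)
    \sum_(N | (N.1 \in Gr gg.1 U) && (N.2 \in Gr gg.2 V)) (#|P N|%:R : C));
  last first.
  apply: eq_bigr => gg _.
  under eq_bigr => N /andP[N1 N2] do rewrite (card_subrep_type_euler N1 N2).
  rewrite sumr_const -[LHS]mulr_natr -!mulrA -natrM; congr (_ * (_ * _%:R)).
  by rewrite -cardsX; apply: eq_card => -[N1 N2]; rewrite in_setX unfold_in.
under [RHS]eq_bigr do rewrite big_mkcond.
rewrite [RHS]exchange_big /= big_mkcond.
apply: eq_bigr => N _; under eq_bigr => gg do rewrite rkP.
rewrite /ok; case: (is_subrep U N.1); last by rewrite big1.
case: (is_subrep V N.2); last by rewrite big1.
by rewrite -big_mkcond /=; rewrite sum_pred1_seq ?uniq_splits.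
Qed.

End Euler.

(** * Coefficients of int_Delta *)

Section Coefficients.
Variables (R : realType) (k : finFieldType) (Q : quiver).
Local Notation C := R[i].
Local Notation cl := (isocl k Q).
Local Notation aut := (cl_aut R (k := k) (Q := Q)).
Local Notation hall := (cl_hall R (k := k) (Q := Q)).
Implicit Types (X Y Z : cl) (a b g : dimvec Q).

Lemma sum_Gr_classes a1 a2 (U : rep k Q a1) (V : rep k Q a2) g :
  (\sum_(Z <- classes_of k (a1 + a2)%R)
     #|[set c | iso (ext_rep U V c) (crep Z)]| * #|Gr g (crep Z)| =
   \sum_c #|Gr g (ext_rep U V c)|)%N.
Proof.
transitivity (\sum_(Z <- classes_of k (a1 + a2)%R) \sum_c
    iso (ext_rep U V c) (crep Z) * #|Gr g (ext_rep U V c)|)%N.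
  apply: eq_bigr => Z _; rewrite -sum1_card big_distrl /= big_mkcond.
  apply: eq_bigr => c _; rewrite inE; case: ifP => // cZ.
  by rewrite (card_Gr_iso g cZ).
rewrite exchange_big; apply: eq_bigr => c _ /=.
rewrite -big_distrl /= sum_iso_classes.
have -> : [forall v, (a1 v + a2 v)%N == (a1 + a2) v]; last by rewrite mul1n.
by apply/forallP => v; rewrite dim_addE.
Qed.

Lemma aut_neq0 X : aut X != 0.
Proof. by rewrite pnatr_eq0 -lt0n aut_card_gt0. Qed.

Lemma hall_neq0_dim X Y Z : hall X Y Z != 0 -> cdim X + cdim Y = cdim Z.
Proof.
rewrite pnatr_eq0 => /hall_num_dim H.
by apply/ffunP => v; rewrite dim_addE -H.
Qed.

Lemma hall_riedtmann X Y Z :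
  hall X Y Z / aut Z = (aut X * aut Y)^-1 / #|{: vmaps k (cdim X) (cdim Y)}|%:R *
    #|[set c | iso (ext_rep (crep X) (crep Y) c) (crep Z)]|%:R.
Proof.
have E := congr1 (fun n => n%:R : C) (riedtmann (crep X) (crep Y) (crep Z)).
rewrite /= !natrM in E.
have n0 : #|{: vmaps k (cdim X) (cdim Y)}|%:R != 0 :> C.
  by rewrite pnatr_eq0 -lt0n; apply/card_gt0P; exists [ffun v => 0].
have := aut_neq0 X; have := aut_neq0 Y; have := aut_neq0 Z.
rewrite /cl_aut /cl_hall => z0 y0 x0.
apply: (mulIf z0); rewrite divfK // -[RHS]mulrA -E.
by field; rewrite x0 y0 n0.
Qed.

(** The left side of the identity for Grassmannians of extensions. *)
Definition twisted_Gr a1 a2 (U : rep k Q a1) (V : rep k Q a2) g : C :=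
  \sum_(gg <- splits a1 a2 g)
     euler R k gg.1 (dim_sub a2 gg.2) * #|Gr gg.1 U|%:R * #|Gr gg.2 V|%:R.

Lemma card_cocycle_neq0 a1 a2 : #|{: cocycle k a1 a2}|%:R != 0 :> C.
Proof. by rewrite pnatr_eq0 -lt0n; apply/card_gt0P; exists [ffun e => 0]. Qed.

(** The coefficient of y^g in int_Delta ([X][Y]), by Riedtmann's formula. *)
Lemma sum_hall_Gr X Y g :
  \sum_(Z <- classes_of k (cdim X + cdim Y))
    hall X Y Z / aut Z * #|Gr g (crep Z)|%:R =
  (aut X * aut Y)^-1 / euler R k (cdim X) (cdim Y) *
    twisted_Gr (crep X) (crep Y) g.
Proof.
transitivity (\sum_(Z <- classes_of k (cdim X + cdim Y))
    (aut X * aut Y)^-1 / #|{: vmaps k (cdim X) (cdim Y)}|%:R *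
    (#|[set c | iso (ext_rep (crep X) (crep Y) c) (crep Z)]| *
     #|Gr g (crep Z)|)%:R).
  by apply: eq_bigr => Z _; rewrite hall_riedtmann natrM mulrA.
rewrite -mulr_sumr -natr_sum sum_Gr_classes (sum_Gr_ext R) -/(twisted_Gr _ _ _).
rewrite -card_cocycle_euler mulrA; congr (_ * _).
have := card_cocycle_neq0 (cdim X) (cdim Y).
have := euler_neq0 R k (cdim X) (cdim Y).
have := aut_neq0 X; have := aut_neq0 Y => y0 x0 e0 c0.
by field; rewrite x0 y0 c0 e0.
Qed.

Lemma int_DeltaE (f : hallalg R k Q) b g :
  int_Delta R k Q f (b, g) =
  \sum_(Z <- classes_of k (b + g)) f Z / aut Z * #|Gr g (crep Z)|%:R.
Proof.
rewrite /int_Delta /int_tensor /hall_comul /=.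
rewrite (@fsbig_seq_supp _ _
  [seq (X, Y) | X <- classes_of k b, Y <- classes_of k g]); first last.
- move=> [X Y] /= [Xb Yg] /allpairsP; case; exists (X, Y) => /=.
  by rewrite !mem_classes Xb Yg !eqxx.
- by move=> _ /allpairsP[[X Y] /= [+ + ->]]; rewrite !mem_classes => /eqP ? /eqP ?.
- by rewrite allpairs_uniq ?uniq_classes // => -[? ?] [? ?] _ _ [-> ->].
rewrite big_allpairs.
transitivity (\sum_(X <- classes_of k b) \sum_(Y <- classes_of k g)
   \sum_(Z <- classes_of k (b + g)) f Z / aut Z * hall X Y Z).
  rewrite big_seq [RHS]big_seq; apply: eq_bigr => X; rewrite mem_classes => /eqP Xb.
  rewrite big_seq [RHS]big_seq; apply: eq_bigr => Y; rewrite mem_classes => /eqP Yg.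
  rewrite (@fsbig_seq_supp _ _ (classes_of k (b + g))) ?uniq_classes //=; last first.
    move=> Z _; rewrite mem_classes => Zn.
    have [-> | /hall_neq0_dim ZE] := eqVneq (hall X Y Z) 0.
      by rewrite mul0r mulr0.
    by rewrite -ZE Xb Yg eqxx in Zn.
  rewrite mulr_suml; apply: eq_bigr => Z _.
  have := aut_neq0 X; have := aut_neq0 Y; have := aut_neq0 Z => z0 y0 x0.
  by field; rewrite x0 y0 z0.
under [LHS]eq_bigr => X _ do rewrite exchange_big.
rewrite exchange_big /= big_seq [RHS]big_seq.
apply: eq_bigr => Z; rewrite mem_classes => /eqP Zd.
under eq_bigr do rewrite -mulr_sumr.
rewrite -mulr_sumr; congr (_ * _).
rewrite -(sum_hall_num (crep Z) (b := b)) ?natr_sum; last first.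
  by move=> v; rewrite Zd dim_addE.
by apply: eq_bigr => X _; rewrite natr_sum.
Qed.

Lemma int_Delta_linear : linear (int_Delta R k Q).
Proof.
move=> c f h; apply/funext => -[b g].
rewrite -[RHS]/((c : C) * (int_Delta R k Q f (b, g) : C) +
                (int_Delta R k Q h (b, g) : C)).
rewrite !int_DeltaE mulr_sumr -big_split; apply: eq_bigr => Z _ /=.
rewrite -[(_ + _) Z]/((c : C) * (f Z : C) + (h Z : C)).
by rewrite !mulrDl !mulrA.
Qed.

Lemma int_Delta_basis a (W : rep k Q a) :
  int_Delta R k Q (hall_basis R (iclass W)) =
  (aut_card W)%:R^-1 *:
    \sum_(g \in [set g : dimvec Q | dim_le g a]%classic)
      #|Gr g W|%:R *: pow_mono R (dim_sub a g) g.
Proof.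
apply/funext => -[b g]; rewrite int_DeltaE.
rewrite (@fsbig_seq_supp _ _ (below a)) ?uniq_below; first last.
- by move=> x /=; rewrite -mem_below => ->.
- by move=> x; rewrite mem_below.
- by [].
pose S s : powalg R Q := \sum_(x <- s) #|Gr x W|%:R *: pow_mono R (dim_sub a x) x.
rewrite -[RHS]/((aut_card W)%:R^-1 * S (below a) (b, g)).
have -> : S (below a) (b, g) = \sum_(x <- below a)
    if g == x then (b == dim_sub a g)%:R * #|Gr g W|%:R else 0.
  rewrite /S.
  elim: (below a) => [|x s IH]; first by rewrite !big_nil.
  rewrite !big_cons -IH -[LHS]/(#|Gr x W|%:R * ((b, g) == (dim_sub a x, x))%:R + _).
  congr (_ + _); rewrite xpair_eqE andbC.
  by case: eqP => [-> | _]; rewrite ?mulr0 // mulrC.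
rewrite -big_mkcond sum_pred1_seq ?uniq_below // mem_below /=.
transitivity (\sum_(Z <- classes_of k (b + g))
    if iclass W == Z then (aut_card W)%:R^-1 * #|Gr g W|%:R else 0 : C).
  apply: eq_bigr => Z _; rewrite /hall_basis eq_sym.
  case: eqP => [<- | _]; last by rewrite !mul0r.
  have WW := iso_crep_iclass W.
  by rewrite mul1r /cl_aut (aut_card_iso WW) (card_Gr_iso g WW).
rewrite -big_mkcond sum_pred1_seq ?uniq_classes // mem_classes cdim_iclass.
case: (altP (a =P b + g)) => [aE | abg].
  have -> : dim_le g a by apply/dim_leP => v; rewrite aE dim_addE leq_addl.
  have -> : b == dim_sub a g; last by rewrite mul1r.
  by apply/eqP/ffunP => v; rewrite ffunE aE dim_addE addnK.
case: ifP => [/dim_leP ga | _]; last by rewrite mulr0.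
have -> : (b == dim_sub a g) = false; last by rewrite mul0r mulr0.
apply: contraNF abg => /eqP ->; apply/eqP/ffunP => v.
by rewrite dim_addE ffunE subnK.
Qed.

Lemma sum_Ext_mid_Gr a1 a2 (U : rep k Q a1) (V : rep k Q a2) g :
  \sum_(gg \in [set gg : dimvec Q * dimvec Q |
          [/\ dim_le gg.1 a1, dim_le gg.2 a2 & gg.1 + gg.2 = g]]%classic)
    euler R k gg.1 (dim_sub a2 gg.2) * #|Gr gg.1 U|%:R * #|Gr gg.2 V|%:R =
  \sum_(W \in [set: cl]%classic)
    (#|Ext_mid U V (crep W)|%:R / #|Ext U V|%:R : C) * #|Gr g (crep W)|%:R.
Proof.
rewrite (@fsbig_seq_supp _ _ (splits a1 a2 g)) ?uniq_splits; first last.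
- by move=> gg /= [g1 g2 gE]; rewrite mem_splits g1 g2 gE eqxx.
- by move=> gg; rewrite mem_splits => /and3P[? ? /eqP].
- by [].
have b0 : #|cobounds U V|%:R != 0 :> C by rewrite pnatr_eq0 -lt0n card_cobounds_gt0.
have c0 := card_cocycle_neq0 a1 a2.
have ratio (W : cl) : #|Ext_mid U V (crep W)|%:R / #|Ext U V|%:R =
    #|[set c | iso (ext_rep U V c) (crep W)]|%:R / #|{: cocycle k a1 a2}|%:R :> C.
  move: c0; rewrite card_Ext_mid (card_Ext U V) !natrM mulf_eq0 negb_or.
  move=> /andP[E0 _].
  by field; rewrite b0 E0.
rewrite (@fsbig_seq_supp _ _ (classes_of k (a1 + a2))) ?uniq_classes; first last.
- move=> W _ Wn; rewrite ratio eq_card0 ?mul0r // => c.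
  rewrite inE; apply: contraNF Wn => cW; rewrite mem_classes.
  by apply/eqP/ffunP => v; rewrite -(iso_dim cW) dim_addE.
- by [].
- by [].
under [RHS]eq_bigr do rewrite ratio mulrAC -natrM.
rewrite -mulr_suml -natr_sum sum_Gr_classes sum_Gr_ext.
by rewrite mulrAC divff // mul1r.
Qed.

Lemma vmaps0_eq (g h : vmaps k ([ffun=> 0%N] : dimvec Q)
    ([ffun=> 0%N] : dimvec Q)) : g = h.
Proof.
apply/ffunP => v; apply/matrixP => -[i lti].
by exfalso; rewrite ffunE in lti.
Qed.

Lemma aut_card_zero_rep : aut_card (zero_rep k Q) = 1%N.
Proof.
have /existsP[g gI] := iso_refl (zero_rep k Q).
rewrite /aut_card (eq_card (B := pred1 g)) ?card1 // => h.
by rewrite (vmaps0_eq h g) !inE gI eqxx.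
Qed.

Lemma zero_subrep_Gr (d : vert Q -> nat) (W : rep k Q d) :
  ([ffun v => 0] : vmaps k d d) \in Gr 0 W.
Proof.
rewrite inE; apply/andP; split; last first.
  by apply/forallP => v; rewrite ffunE mxrank0 ffunE.
apply/andP; split; first by apply/forallP => v; rewrite ffunE genmx0.
by apply/forallP => e; rewrite !ffunE mul0mx sub0mx.
Qed.

Lemma Gr_zero_rep : #|Gr 0 (zero_rep k Q)| = 1%N.
Proof.
have [N0 N0P] : exists N0, N0 \in Gr 0 (zero_rep k Q).
  by eexists; apply: zero_subrep_Gr.
rewrite (eq_card (B := pred1 N0)) ?card1 // => h.
by rewrite (vmaps0_eq h N0) N0P inE eqxx.
Qed.

Lemma int_Delta_one : int_Delta R k Q (hall_one R k Q) = pow_one R Q.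
Proof.
rewrite int_Delta_basis (@fsbig_seq_supp _ _ [:: 0 : dimvec Q]) //; last first.
- move=> x /= /dim_leP x0; rewrite inE => /eqP[]; apply/ffunP => v.
  by have := x0 v; rewrite !ffunE leqn0 => /eqP.
- by move=> x; rewrite inE => /eqP ->; apply/dim_leP => v; rewrite !ffunE.
rewrite big_seq1 aut_card_zero_rep Gr_zero_rep invr1 !scale1r.
congr pow_mono; by apply/ffunP => v; rewrite !ffunE.
Qed.

End Coefficients.

(** * Multiplicativity *)

Section Multiplicativity.
Variables (R : realType) (k : finFieldType) (Q : quiver).
Local Notation C := R[i].
Local Notation cl := (isocl k Q).
Local Notation aut := (cl_aut R (k := k) (Q := Q)).
Local Notation hall := (cl_hall R (k := k) (Q := Q)).
Implicit Types (X Y Z : cl) (a b g : dimvec Q).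

Lemma dim_subK b s : dim_le s b -> s + dim_sub b s = b.
Proof. by move=> /dim_leP sb; apply/ffunP => v; rewrite dim_addE ffunE subnKC. Qed.

Lemma dim_addKl a b : dim_sub (a + b) a = b.
Proof. by apply/ffunP => v; rewrite ffunE dim_addE addKn. Qed.

Lemma dim_le_addr a b : dim_le a (a + b).
Proof. by apply/dim_leP => v; rewrite dim_addE leq_addr. Qed.

Lemma dim_le_addl a b : dim_le a (b + a).
Proof. by rewrite addrC dim_le_addr. Qed.

Definition classes_le a : seq cl :=
  undup (flatten [seq classes_of k b | b <- below a]).

Lemma mem_classes_le X a : (X \in classes_le a) = dim_le (cdim X) a.
Proof.
rewrite mem_undup -mem_below; apply/flatten_mapP/idP => [[b ba] | Xa].
  by rewrite mem_classes => /eqP ->.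
by exists (cdim X); rewrite ?mem_classes.
Qed.

Lemma sum_classes_le (F : cl -> C) a b : dim_le b a ->
  \sum_(X <- classes_of k b) F X = \sum_(X <- classes_le a | cdim X == b) F X.
Proof.
move=> ba; rewrite -[RHS]big_filter; apply: perm_big; apply: uniq_perm.
- exact: uniq_classes.
- by rewrite filter_uniq // undup_uniq.
move=> X; rewrite mem_filter mem_classes mem_classes_le.
by case: eqP => // ->.
Qed.

Lemma hall_mulE (f h : hallalg R k Q) Z a : cdim Z = a ->
  hall_mul R k Q f h Z =
  \sum_(X <- classes_le a) \sum_(Y <- classes_le a)
    f X * h Y * hall X Y Z.
Proof.
move=> <-.
rewrite /hall_mul (@fsbig_seq_supp _ _
  [seq (X, Y) | X <- classes_le (cdim Z), Y <- classes_le (cdim Z)]).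
- by rewrite big_allpairs.
- by rewrite allpairs_uniq ?undup_uniq // => -[? ?] [? ?] _ _ [-> ->].
- by [].
move=> [X Y] _ /= XYn.
have [-> | /hall_neq0_dim E] := eqVneq (hall X Y Z) 0; first by rewrite mulr0.
case/negP: XYn; apply/allpairsP; exists (X, Y); split=> //=.
  by rewrite mem_classes_le -E dim_le_addr.
by rewrite mem_classes_le -E dim_le_addl.
Qed.

Lemma pow_mulE (p r : powalg R Q) b g :
  pow_mul R k Q p r (b, g) =
  \sum_(s1 <- below b) \sum_(s2 <- below g)
    p (s1, s2) * r (dim_sub b s1, dim_sub g s2) *
    (euler R k s2 (dim_sub b s1) /
     euler R k (s1 + s2) (dim_sub b s1 + dim_sub g s2)).
Proof.
rewrite /pow_mul (@fsbig_seq_supp _ _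
  [seq ((s1, s2), (dim_sub b s1, dim_sub g s2)) | s1 <- below b, s2 <- below g]).
- by rewrite big_allpairs_dep.
- by rewrite allpairs_uniq ?uniq_below // => -[? ?] [? ?] _ _ [-> ->].
- move=> _ /allpairsP[[s1 s2] /= [+ + ->]]; rewrite !mem_below => s1b s2g.
  by rewrite /= !dim_subK.
move=> [[s1 s2] [t1 t2]] /= [E1 E2] /negP[]; apply/allpairsP; exists (s1, s2).
by rewrite -E1 -E2 !dim_addKl !mem_below !dim_le_addr.
Qed.

(** A factorisation of x^b y^g into monomials x^(s1) y^(s2) and x^(t1) y^(t2) with
    s1 + s2 = dim X and t1 + t2 = dim Y is determined by the pair (s2, t2), which
    ranges over the decompositions of g into dimensions bounded by those of X
    and Y. *)
Lemma sum_splits X Y b g :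
  \sum_(s1 <- below b) \sum_(s2 <- below g)
    (if (cdim X == s1 + s2) && (cdim Y == dim_sub b s1 + dim_sub g s2) then
       euler R k s2 (dim_sub b s1) *
       #|Gr s2 (crep X)|%:R * #|Gr (dim_sub g s2) (crep Y)|%:R
     else 0)
  = if cdim X + cdim Y == b + g then twisted_Gr R (crep X) (crep Y) g else 0.
Proof.
pose F (s : dimvec Q * dimvec Q) := euler R k s.2 (dim_sub b s.1) *
  #|Gr s.2 (crep X)|%:R * #|Gr (dim_sub g s.2) (crep Y)|%:R.
pose c (s : dimvec Q * dimvec Q) :=
  (cdim X == s.1 + s.2) && (cdim Y == dim_sub b s.1 + dim_sub g s.2).
transitivity (\sum_(s <- [seq (s1, s2) | s1 <- below b, s2 <- below g] | c s) F s).
  by rewrite [RHS]big_mkcond big_allpairs.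
have [E | nE] := eqVneq (cdim X + cdim Y) (b + g); last first.
  rewrite big_seq_cond big1 // => -[s1 s2].
  move=> /andP[/allpairsP[[x y] /= [xb yg [-> ->]]] /andP[/= /eqP EX /eqP EY]].
  rewrite !mem_below in xb yg; case/eqP: nE.
  by rewrite EX EY addrACA !dim_subK.
have Ev v : (cdim X v + cdim Y v = b v + g v)%N.
  by have /ffunP/(_ v) := E; rewrite !dim_addE.
pose t (s : dimvec Q * dimvec Q) := (s.2, dim_sub g s.2).
have tE : perm_eq (splits (cdim X) (cdim Y) g) [seq t s | s <- splits b g (cdim X)].
  apply: uniq_perm; first exact: uniq_splits.
    rewrite map_inj_in_uniq ?uniq_splits // => -[s1 s2] [s1' s2'].
    rewrite !mem_splits => /and3P[_ _ /= /eqP E1] /and3P[_ _ /= /eqP E2] [ss _].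
    subst s2'; congr pair; apply/ffunP => v.
    move/ffunP/(_ v): E1; move/ffunP/(_ v): E2.
    by rewrite !dim_addE; lia.
  move=> [g1 g2]; rewrite mem_splits; apply/and3P/mapP => /=.
    move=> [/dim_leP g1X /dim_leP g2Y /eqP gE].
    exists (dim_sub (cdim X) g1, g1); last by rewrite /t /= -gE dim_addKl.
    rewrite mem_splits /= -gE dim_le_addr; apply/and3P; split=> //.
      apply/dim_leP => v; rewrite ffunE.
      have gv : (g1 v + g2 v = g v)%N by rewrite -gE dim_addE.
      have aux (x y p q r s : nat) :
        (x + y = p + q -> r + s = q -> s <= y -> x - r <= p)%N by lia.
      exact: aux (Ev v) gv (g2Y v).
    by apply/eqP; rewrite addrC dim_subK //; apply/dim_leP.
  move=> [[s1 s2]]; rewrite mem_splits /t /=.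
  move=> /and3P[/dim_leP s1b s2g /eqP sE] [-> ->]; split.
  - by rewrite -sE dim_le_addl.
  - apply/dim_leP => v; rewrite ffunE.
    have : (s1 v + s2 v = cdim X v)%N by rewrite -sE dim_addE.
    by move: (Ev v) (s1b v); move/dim_leP/(_ v): s2g; lia.
  by rewrite dim_subK.
rewrite /twisted_Gr (perm_big _ tE) /= big_map /splits [RHS]big_filter.
rewrite big_seq_cond [RHS]big_seq_cond; apply: eq_big => -[s1 s2].
  have [/allpairsP[[x y] /= [xb yg [-> ->]]] | //] := boolP (_ \in _).
  rewrite /c /= eq_sym; case: eqP => //= sX.
  rewrite !mem_below in xb yg; apply/eqP/ffunP => v.
  have aux (m n p q r s : nat) :
    (m + n = p + q -> r + s = m -> r <= p -> s <= q ->
     n = (p - r) + (q - s))%N by lia.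
  rewrite dim_addE !ffunE.
  apply: aux (Ev v) _ (dim_leP _ _ xb v) (dim_leP _ _ yg v).
  by rewrite -sX dim_addE.
move=> /andP[/allpairsP[[x y] /= [xb yg [-> ->]]] /andP[/= /eqP EX /eqP EY]].
rewrite /F /t /=; congr (euler R k _ _ * _ * _).
by rewrite EY addrC dim_addKl.
Qed.

(** Both sides are bilinear in f and h; the coefficients of f X * h Y are compared
    by [sum_hall_Gr] and [sum_splits]. *)
Lemma int_Delta_mul (f h : hallalg R k Q) :
  int_Delta R k Q (hall_mul R k Q f h) =
  pow_mul R k Q (int_Delta R k Q f) (int_Delta R k Q h).
Proof.
apply/funext => -[b g]; rewrite int_DeltaE pow_mulE; set a := b + g.
transitivity (\sum_(X <- classes_le a) \sum_(Y <- classes_le a)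
   f X * h Y * ((aut X * aut Y)^-1 / euler R k (cdim X) (cdim Y)) *
   (if cdim X + cdim Y == a then twisted_Gr R (crep X) (crep Y) g else 0)).
  transitivity (\sum_(Z <- classes_of k a)
    \sum_(X <- classes_le a) \sum_(Y <- classes_le a)
     f X * h Y * (hall X Y Z / aut Z * #|Gr g (crep Z)|%:R)).
    rewrite big_seq [RHS]big_seq; apply: eq_bigr => Z.
    rewrite mem_classes => /eqP Za; rewrite (hall_mulE _ _ Za) !mulr_suml; apply: eq_bigr => X _.
    by rewrite !mulr_suml; apply: eq_bigr => Y _; rewrite !mulrA.
  rewrite exchange_big; apply: eq_bigr => X _.
  rewrite exchange_big; apply: eq_bigr => Y _ /=.
  rewrite -mulr_sumr -[RHS]mulrA; congr (_ * _).
  have [E | nE] := eqVneq (cdim X + cdim Y) a.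
    by rewrite -E sum_hall_Gr.
  rewrite mulr0 big_seq big1 // => Z; rewrite mem_classes => /eqP Za.
  have [-> | /hall_neq0_dim E] := eqVneq (hall X Y Z) 0.
    by rewrite !mul0r.
  by rewrite E Za eqxx in nE.
transitivity (\sum_(s1 <- below b) \sum_(s2 <- below g)
   \sum_(X <- classes_le a) \sum_(Y <- classes_le a)
     f X * h Y * ((aut X * aut Y)^-1 / euler R k (cdim X) (cdim Y)) *
     (if (cdim X == s1 + s2) && (cdim Y == dim_sub b s1 + dim_sub g s2) then
        euler R k s2 (dim_sub b s1) *
        #|Gr s2 (crep X)|%:R * #|Gr (dim_sub g s2) (crep Y)|%:R
      else 0)).
  under [RHS]eq_bigr => s1 _ do rewrite exchange_big.
  rewrite [RHS]exchange_big; apply: eq_bigr => X _ /=.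
  under [RHS]eq_bigr => s1 _ do rewrite exchange_big.
  rewrite [RHS]exchange_big; apply: eq_bigr => Y _ /=.
  rewrite -sum_splits mulr_sumr; apply: eq_bigr => s1 _.
  by rewrite mulr_sumr.
rewrite big_seq [RHS]big_seq; apply: eq_bigr => s1; rewrite mem_below => s1b.
rewrite big_seq [RHS]big_seq; apply: eq_bigr => s2; rewrite mem_below => s2g.
have s12 : dim_le (s1 + s2) a.
  apply/dim_leP => v; rewrite !dim_addE leq_add //.
    by move/dim_leP: s1b.
  by move/dim_leP: s2g.
have t12 : dim_le (dim_sub b s1 + dim_sub g s2) a.
  by apply/dim_leP => v; rewrite !dim_addE !ffunE leq_add // leq_subr.
rewrite !int_DeltaE (sum_classes_le _ s12) (sum_classes_le _ t12).
rewrite -mulrA mulr_suml [RHS]big_mkcond; apply: eq_bigr => X _.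
case: eqP => [EX | _] /=; last by rewrite big1 // => Y _; rewrite mulr0.
rewrite -EX mulr_suml mulr_sumr [RHS]big_mkcond; apply: eq_bigr => Y _.
case: eqP => [EY | _] /=; last by rewrite mulr0.
rewrite -EY; have := aut_neq0 R X; have := aut_neq0 R Y.
by have := euler_neq0 R k (cdim X) (cdim Y) => e0 y0 x0; field; rewrite e0 y0 x0.
Qed.

End Multiplicativity.

Theorem proposition2p8 (R : realType) (k : finFieldType) (Q : quiver) :
  [/\ algebra_morphism (hall_one R k Q) (hall_mul R k Q)
        (pow_one R Q) (pow_mul R k Q) (int_Delta R k Q),
      forall (alpha : dimvec Q) (W : rep k Q alpha),
        int_Delta R k Q (hall_basis R (iclass W)) =
        (aut_card W)%:R^-1 *:
          \sum_(g \in [set g : dimvec Q | dim_le g alpha]%classic)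
            #|Gr g W|%:R *: pow_mono R (dim_sub alpha g) g
    & forall (alpha1 alpha2 : dimvec Q) (U : rep k Q alpha1)
        (V : rep k Q alpha2) (g : dimvec Q),
        \sum_(gg \in [set gg : dimvec Q * dimvec Q |
                [/\ dim_le gg.1 alpha1, dim_le gg.2 alpha2
                  & gg.1 + gg.2 = g]]%classic)
          euler R k gg.1 (dim_sub alpha2 gg.2)
            * #|Gr gg.1 U|%:R * #|Gr gg.2 V|%:R =
        \sum_(W \in [set: isocl k Q]%classic)
          (#|Ext_mid U V (crep W)|%:R / #|Ext U V|%:R : R[i])
            * #|Gr g (crep W)|%:R ].
Proof.
split; [split | exact: int_Delta_basis | exact: sum_Ext_mid_Gr].
- exact: int_Delta_linear.
- exact: int_Delta_one.
exact: int_Delta_mul.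
Qed.
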